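(* Let $0<\epsilon<1$ be fixed. Suppose that Assumption 2 holds and that at least one of Assumption 1.1 and Assumption 1.2 holds (these assumptions are stated in the context). Suppose moreover that for every $C\subseteq V$ with $|C|=r$, \[ \max_{\emptyset\neq D\subseteq C}\frac{\mathbb{E}_0[e(D)]\,h(\rho_C-1)}{|D|\log(n/|D|)}\le 1-\epsilon . \] Then every sequence of tests is asymptotically powerless, i.e. $R_n(\psi_n)\to 1$ for every sequence of tests $(\psi_n)$.
   Context: Setting. For each $n$ let $V=\{1,\dots,n\}$, let $p_{ij}=p_{ji}\in[0,1]$ ($i\neq j$) be given edge probabilities, let $r=r_n$ be a community size, and for every $C\subseteq V$ with $|C|=r$ let $\rho_C>1$ be a scaling with $\rho_C p_{ij}\le 1$ for $i,j\in C$. All of these may depend on $n$, and all limits are as $n\to\infty$. One observes a simple undirected graph on $V$ with adjacency matrix $A$ ($A_{ii}=0$). Under the null distribution $\mathbb{P}_0$ the $A_{ij}$, $i<j$, are independent with $A_{ij}\sim\mathrm{Bern}(p_{ij})$. Under $\mathbb{P}_C$ (planted community $C$, $|C|=r$) they are independent with $A_{ij}\sim\mathrm{Bern}(\rho_C p_{ij})$ if $i,j\in C$, and $A_{ij}\sim\mathrm{Bern}(p_{ij})$ otherwise. $\mathbb{E}_0$ and $\mathbb{E}_C$ denote the corresponding expectations. Tests. A test $\psi_n$ is a map from graphs on $V$ to $\{0,1\}$. Its worst-case risk is $R_n(\psi_n)=\mathbb{P}_0(\psi_n\neq 0)+\max_{C\subseteq V,|C|=r}\mathbb{P}_C(\psi_n\neq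 1)$. A sequence of tests is asymptotically powerless if $R_n(\psi_n)\to1$. Notation. $e(D)=\sum_{i<j,\ i,j\in D}A_{ij}$ is the number of edges inside $D$. $h(x)=(x+1)\log(x+1)-x$. For $D\subseteq V$ with $|D|\ge2$ the average edge probability is $\bar p_D=\mathbb{E}_0[e(D)]/\binom{|D|}{2}$. Assumption 1.1. There exists $\delta\in(0,1/2)$ such that: (i) $r=O(n^{1/2-\delta})$; (ii) there exists a sequence $0<\gamma_n=o(1)$ with $\max_{C\subseteq V,|C|=r}\ \max_{D\subseteq C,\ |D|<r/(n/r)^{\gamma_n}}\frac{|D|\,\bar p_D}{|C|\,\bar p_C}\le\delta$; (iii) $\max_{C\subseteq V,|C|=r}1/\bar p_C=o\big(r/\log(n/r)\big)$. Assumption 1.2. (i) $r=n^{o(1)}$; (ii) $\max_{C\subseteq V,|C|=r}\log(1/\bar p_C)=o\big(\log(n/r)/\log r\big)$. Assumption 2. $\max_{C\subseteq V,|C|=r}\max_{i,j\in C}\rho_C^2p_{ij}\to0$.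
   Formalization: The conclusion R_n(ψ_n)→1 for every sequence of tests is replaced by liminf R_n(ψ_n)≥1, since a perverse test (accepting the null exactly when a fixed community C_0 looks planted) can have risk tending to 2. *)

(* Defs.v *)
From HB Require Import structures.
From mathcomp Require Import all_boot all_order all_algebra.
From mathcomp Require Import all_classical all_reals all_analysis.
Set Implicit Arguments. Unset Strict Implicit. Unset Printing Implicit Defensive.
Import Order.TTheory GRing.Theory Num.Theory.
Local Open Scope classical_set_scope.
Local Open Scope ring_scope.

Section Defs.
Variable R : realType.

(* unordered pairs {i,j} of V = 'I_n, represented as (i,j) with i < j *)
Definition vpair (n : nat) := {x : 'I_n * 'I_n | (x.1 < x.2)%N}.
(* a simple undirected graph on V: its upper-triangular adjacency entries *)
Definition graph (n : nat) := {ffun vpair n -> bool}.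
Definition test (n : nat) := graph n -> bool.

Definition edgeprob n (q : 'I_n -> 'I_n -> R) (A : graph n) : R :=
  \prod_(e : vpair n)
     (if A e then q (val e).1 (val e).2 else 1 - q (val e).1 (val e).2).
Definition prob n (q : 'I_n -> 'I_n -> R) (S : pred (graph n)) : R :=
  \sum_(A : graph n | S A) edgeprob q A.
Definition expect n (q : 'I_n -> 'I_n -> R) (f : graph n -> R) : R :=
  \sum_(A : graph n) edgeprob q A * f A.

Definition planted n (p : 'I_n -> 'I_n -> R) (rho : {set 'I_n} -> R)
  (C : {set 'I_n}) (i j : 'I_n) : R :=
  if (i \in C) && (j \in C) then rho C * p i j else p i j.

(* max over communities C with |C| = r (0 if there are none) *)
Definition maxC n (r : nat) (f : {set 'I_n} -> R) : R :=
  \big[Num.max/0]_(C : {set 'I_n} | #|C| == r) f C.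

Definition risk n (p : 'I_n -> 'I_n -> R) (rho : {set 'I_n} -> R) (r : nat)
  (psi : test n) : R :=
  prob p (fun A => psi A != false)
  + maxC r (fun C => prob (planted p rho C) (fun A => psi A != true)).

Definition edges_in n (A : graph n) (D : {set 'I_n}) : nat :=
  \sum_(e : vpair n | ((val e).1 \in D) && ((val e).2 \in D)) A e.
Definition mean_edges n (p : 'I_n -> 'I_n -> R) (D : {set 'I_n}) : R :=
  expect p (fun A => (edges_in A D)%:R).
(* \bar p_D (equal to 0/0 = 0 if |D| < 2) *)
Definition pbar n (p : 'I_n -> 'I_n -> R) (D : {set 'I_n}) : R :=
  mean_edges p D / ('C(#|D|, 2))%:R.

Definition hfun (x : R) : R := (x + 1) * ln (x + 1) - x.

Definition littleo_seq (a b : nat -> R) : Prop :=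
  forall eps : R, 0 < eps -> \forall n \near \oo, `|a n| <= eps * `|b n|.

Definition Assumption11 (p : forall n, 'I_n -> 'I_n -> R) (r : nat -> nat) : Prop :=
  exists delta : R, 0 < delta /\ delta < 1/2 /\
  (exists K : R, \forall n \near \oo,
      (r n)%:R <= K * ((n%:R : R) `^ (1/2 - delta))) /\
  (exists gamma : nat -> R, (forall n, 0 < gamma n) /\ gamma @ \oo --> 0 /\
     \forall n \near \oo, forall C D : {set 'I_n}, #|C| = r n -> D \subset C ->
        (#|D|%:R : R) < (r n)%:R / (((n%:R : R) / (r n)%:R) `^ gamma n) ->
        (#|D|%:R * pbar (p n) D) / (#|C|%:R * pbar (p n) C) <= delta) /\
  littleo_seq (fun n => maxC (r n) (fun C => (pbar (p n) C)^-1))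
              (fun n => (r n)%:R / ln ((n%:R : R) / (r n)%:R)).

Definition Assumption12 (p : forall n, 'I_n -> 'I_n -> R) (r : nat -> nat) : Prop :=
  (exists f : nat -> R, f @ \oo --> 0 /\
     \forall n \near \oo, ((r n)%:R : R) = (n%:R : R) `^ f n) /\
  littleo_seq (fun n => maxC (r n) (fun C => ln ((pbar (p n) C)^-1)))
              (fun n => ln ((n%:R : R) / (r n)%:R) / ln ((r n)%:R)).

Definition Assumption2 (p : forall n, 'I_n -> 'I_n -> R)
  (rho : forall n, {set 'I_n} -> R) (r : nat -> nat) : Prop :=
  let a : nat -> R := fun n => maxC (r n) (fun C =>
      \big[Num.max/0]_(ij : 'I_n * 'I_n | (ij.1 \in C) && (ij.2 \in C) && (ij.1 != ij.2))
         (rho n C ^+ 2 * p n ij.1 ij.2)) in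
  a @ \oo --> 0.

End Defs.

(* Main.v *)
Require Import Defs.
From HB Require Import structures.
From mathcomp Require Import all_boot all_order all_algebra.
From mathcomp Require Import all_classical all_reals all_analysis.
From mathcomp Require Import ring lra.
Import Order.TTheory GRing.Theory Num.Theory.
Import numFieldNormedType.Exports.
Local Open Scope classical_set_scope.
Local Open Scope ring_scope.

(** Averaging over a uniform community, the risk is at least
    [E_0 (min 1 L)], where [L] is the mean of the likelihood ratios [L_C]
    truncated to the event that no [D \subset C] carries too many edges; it
    suffices that [E_0 L] and [E_0 L^2] tend to [1].  By AM-GM the cross moment
    of [C1] and [C2] is at most the mean of two truncated second moments over
    the edges inside [D = C1 :&: C2], and exponential tilting bounds these.
    Cutting [e(D)] at [zeta * E_0 e(D)], where
    [E_0 e(D) * h (zeta - 1) = |D| log (n / |D|)], the second moment is at most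
    [exp (|D| log (n / |D|) - E_0 e(D) * K)] and the truncation costs
    [exp (- E_0 e(D) * K)], where the relative entropy [K] of Poisson laws of
    means [zeta] and [rho] is at least [c * h (zeta - 1) / (1 + log rho)].
    As a random community contains [D] with probability at most
    [(r / n) ^ |D|], the sums over [D] are small once
    [(1 + log (r / |D|)) (1 + log rho) = o (log (n / |D|))].  This holds for all
    [D] under Assumption 1.2, and for [|D| >= r / (n / r) ^ gamma] under
    Assumption 1.1, where smaller [D] need no truncation. *)

(** * Inequalities for [hfun] and for the Poisson relative entropy *)

Section Entropy.
#[local] Set Implicit Arguments.
#[local] Unset Strict Implicit.
#[local] Unset Printing Implicit Defensive.
Variable R : realType.
Implicit Types a b x y z t rho eps E W : R.

Lemma nonneg_derive_ge0 (f df : R -> R) y :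
  (forall x : R, is_derive x (1 : R) f (df x)) -> f 0 = 0 ->
  (forall x, 0 <= x -> 0 <= df x) -> 0 <= y -> 0 <= f y.
Proof.
move=> fd f0 df0 y0.
have fc : {within `[0, y], continuous f}.
  by apply: derivable_within_continuous => x _; by case: (fd x).
have [c] := MVT_segment y0 (fun x _ => fd x) fc.
rewrite in_itv /= => /andP[c0 _]; rewrite f0 !subr0 => ->.
exact: mulr_ge0 (df0 _ c0) y0.
Qed.

(** The difference of the two sides vanishes at [0] and has a derivative that is twice a square.
    This bound and the next become bounds on [hfun (t - 1)] for [t >= 1] under [y = ln t], since
    [t * (ln t - 1 + t^-1) = hfun (t - 1)]. *)
Lemma expRN_quad_ge y : 0 <= y -> (1 - expR (- y)) ^+ 2 <= 2 * (y - 1 + expR (- y)).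
Proof.
move=> y0; rewrite -subr_ge0.
apply: (@nonneg_derive_ge0
  (fun y => 2 * (y - 1 + expR (- y)) - (1 - expR (- y)) ^+ 2)
  (fun y => 2 * (1 - expR (- y)) ^+ 2)) => //.
- by move=> x; apply: is_derive_eq; rewrite /GRing.scale /=; lra.
- by rewrite oppr0 expR0; lra.
- by move=> x _; rewrite mulr_ge0// sqr_ge0.
Qed.

Lemma expRN_sqr_le y : 0 <= y -> y ^+ 2 <= 2 * ((y - 1 + expR (- y)) * (1 + y)).
Proof.
move=> y0; rewrite -subr_ge0.
apply: (@nonneg_derive_ge0
  (fun y => 2 * ((y - 1 + expR (- y)) * (1 + y)) - y ^+ 2)
  (fun y => 2 * y * (1 - expR (- y)))) => //.
- by move=> x; apply: is_derive_eq; rewrite /GRing.scale /=; lra.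
- by rewrite oppr0 expR0; lra.
- move=> x x0; rewrite mulr_ge0 ?mulr_ge0//.
  by rewrite subr_ge0 -expR0 ler_expR; lra.
Qed.

Lemma ln_le_subr1 t : 0 < t -> ln t <= t - 1.
Proof. by move=> t0; have := @le_ln1Dx R (t - 1); rewrite addrCA subrr addr0; apply; lra. Qed.

Lemma hfunE t : hfun (t - 1) = t * ln t - t + 1.
Proof. by rewrite /hfun subrK; lra. Qed.

Lemma hfun_sqr_le t : 1 <= t -> (t - 1) ^+ 2 <= 2 * (t * hfun (t - 1)).
Proof.
move=> t1; have t0 : 0 < t by lra.
have := expRN_quad_ge (ln_ge0 t1); rewrite expRN lnK ?posrE// => h.
have := ler_wpM2l (sqr_ge0 t) h; rewrite hfunE.
have -> : t ^+ 2 * (1 - t^-1) ^+ 2 = (t - 1) ^+ 2 by field; rewrite gt_eqF.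
suff -> : t ^+ 2 * (2 * (ln t - 1 + t^-1)) = 2 * (t * (t * ln t - t + 1)) by [].
by field; rewrite gt_eqF.
Qed.

Lemma ln_sqr_le_hfun t : 1 <= t -> t * ln t ^+ 2 <= 2 * (hfun (t - 1) * (1 + ln t)).
Proof.
move=> t1; have t0 : 0 < t by lra.
have := expRN_sqr_le (ln_ge0 t1); rewrite expRN lnK ?posrE// => h.
have := ler_wpM2l (ltW t0) h; rewrite hfunE.
suff -> : t * (2 * ((ln t - 1 + t^-1) * (1 + ln t))) =
   2 * ((t * ln t - t + 1) * (1 + ln t)) by [].
by field; rewrite gt_eqF.
Qed.

Lemma hfun_ge0 t : 1 <= t -> 0 <= hfun (t - 1).
Proof.
move=> t1; have := hfun_sqr_le t1; have := sqr_ge0 (t - 1).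
move=> h1 h2; have : 0 <= t * hfun (t - 1) by lra.
by rewrite pmulr_rge0//; lra.
Qed.

(* Relative entropy of Poisson variables of means [z] and [rho]. *)
Definition poisson_kl z rho := z * ln z - z * ln rho - z + rho.

Lemma poisson_kl_hfun z rho : 0 < rho -> 0 < z ->
  poisson_kl z rho = rho * hfun (z / rho - 1).
Proof.
move=> r0 z0; rewrite hfunE ln_div ?posrE// /poisson_kl.
by field; rewrite gt_eqF.
Qed.

Lemma poisson_kl_sqr_le z rho : 0 < rho -> rho <= z ->
  (z - rho) ^+ 2 <= 2 * (z * poisson_kl z rho).
Proof.
move=> r0 rz; have z0 : 0 < z by lra.
have zr1 : 1 <= z / rho by rewrite ler_pdivlMr// mul1r.
have := ler_wpM2l (sqr_ge0 rho) (hfun_sqr_le zr1); rewrite (poisson_kl_hfun r0)//.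
have -> : rho ^+ 2 * (z / rho - 1) ^+ 2 = (z - rho) ^+ 2.
  by field; rewrite gt_eqF.
suff -> : rho ^+ 2 * (2 * (z / rho * hfun (z / rho - 1))) =
          2 * (z * (rho * hfun (z / rho - 1))) by [].
by field; rewrite gt_eqF.
Qed.

(** Tangent inequality at [z] for the convex function [hfun (z - 1)], whose slope there is
    [ln z]. *)
Lemma hfun_diff_le z rho : 0 < rho -> rho <= z ->
  hfun (z - 1) - hfun (rho - 1) <= (z - rho) * ln z.
Proof.
move=> r0 rz; have z0 : 0 < z by lra.
have h : ln z - ln rho <= z / rho - 1.
  by rewrite -ln_div ?posrE// ln_le_subr1// divr_gt0.
have := ler_wpM2l (ltW r0) h; rewrite !hfunE.
have -> : rho * (z / rho - 1) = z - rho by field; rewrite gt_eqF.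
by lra.
Qed.

(** With [H = hfun (z - 1)] and [K = poisson_kl z rho], the gap [eps * H] is at most
    [(z - rho) * ln z]. Squaring and inserting the two quadratic bounds gives
    [(eps * H) ^+ 2 <= 4 * K * H * (1 + ln z)]; one factor [H] cancels, and [ln z <= 2 * ln rho]
    leads to the constant [8]. *)
Lemma poisson_kl_ge eps z rho : 0 < eps -> 1 < rho -> rho <= z -> z <= rho ^+ 2 ->
  hfun (rho - 1) <= (1 - eps) * hfun (z - 1) ->
  eps ^+ 2 / 8 * hfun (z - 1) <= poisson_kl z rho * (1 + ln rho).
Proof.
move=> e0 r1 rz zr2 hh.
have r0 : 0 < rho by lra.
have z0 : 0 < z by lra.
set H := hfun (z - 1) in hh *; set K := poisson_kl z rho.
have dL : eps * H <= (z - rho) * ln z.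
  by have := hfun_diff_le r0 rz; rewrite -/H; lra.
have dK : (z - rho) ^+ 2 <= 2 * (z * K) := poisson_kl_sqr_le r0 rz.
have LH : z * ln z ^+ 2 <= 2 * (H * (1 + ln z)) by apply: ln_sqr_le_hfun; lra.
have Lr : ln z <= 2 * ln rho.
  by rewrite mulr_natl -lnXn// ler_ln ?posrE// exprn_gt0.
have lr0 : 0 <= ln rho by apply: ln_ge0; lra.
have H0 : 0 < H.
  have z1 : 0 < (z - 1) ^+ 2 by rewrite exprn_gt0//; lra.
  have := hfun_sqr_le (ltW (lt_le_trans r1 rz)); rewrite -/H => h.
  have : 0 < z * H by lra.
  by rewrite pmulr_rgt0.
have K0 : 0 <= K.
  have h := sqr_ge0 (z - rho).
  have : 0 <= z * K by lra.
  by rewrite pmulr_rge0.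
have : (eps * H) ^+ 2 <= ((z - rho) * ln z) ^+ 2.
  by rewrite lerXn2r ?nnegrE// ?(le_trans _ dL)// mulr_ge0// ltW.
have := ler_wpM2r (sqr_ge0 (ln z)) dK.
have K2 : 0 <= 2 * K by lra.
have := ler_wpM2l K2 LH.
move=> h1 h2 h3; have : H * (eps ^+ 2 * H) <= H * (4 * K * (1 + ln z)) by lra.
rewrite ler_pM2l// => h4.
by have := ler_wpM2l K0 Lr; lra.
Qed.

Lemma hfun_continuous a b : 0 < a ->
  {within `[a, b], continuous (fun z => hfun (z - 1))}.
Proof.
move=> a0; apply: continuous_in_subspaceT => x; rewrite inE/= in_itv/= => /andP[ax _].
have x0 : 0 < x by lra.
have -> : (fun z : R => hfun (z - 1)) = (fun z => z * ln z - z + 1).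
  by apply/funext => z; rewrite hfunE.
apply: cvgD; last exact: cvg_cst.
apply: cvgB; last exact: cvg_id.
by apply: cvgM; [exact: cvg_id|exact: continuous_ln].
Qed.

(** Here [z] is the truncation level in units of the null mean [E]. It solves [E * hfun (z - 1) = W]
    but is capped at [rho ^+ 2], where the tilt [z / rho ^+ 2] used later becomes trivial. *)
Lemma tilt_exists eps rho E W :
  0 < eps -> eps <= 1/2 -> 1 < rho -> 0 <= E -> 0 < W ->
  E * hfun (rho - 1) <= (1 - eps) * W ->
  exists z, [/\ rho <= z, z <= rho ^+ 2,
    E * (hfun (z - 1) - 2 * poisson_kl z rho
         + eps ^+ 2 / 16 * ((rho - 1) ^+ 2 / rho ^+ 2))
      <= W * (1 - eps ^+ 2 / 8 / (1 + ln rho)) &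
    z = rho ^+ 2 \/ eps ^+ 2 / 8 / (1 + ln rho) * W <= E * poisson_kl z rho].
Proof.
move=> e0 e12 r1 E0 W0 hE; have r0 : 0 < rho by lra.
have rr2 : rho <= rho ^+ 2 by rewrite expr2 ler_pMr//; lra.
have [z [rz zr2 hz EW EWeq]] : exists z, [/\ rho <= z, z <= rho ^+ 2,
    hfun (rho - 1) <= (1 - eps) * hfun (z - 1), E * hfun (z - 1) <= W &
    z = rho ^+ 2 \/ E * hfun (z - 1) = W].
  have [Er2|Er2] := leP (E * hfun (rho ^+ 2 - 1)) W.
    exists (rho ^+ 2); split=> //; last by left.
    have h0 : 0 <= hfun (rho - 1) by apply: hfun_ge0; lra.
    (* This identity makes [hfun (rho ^+ 2 - 1)] at least twice [hfun (rho - 1)], and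
       [1 - eps >= 1/2] does the rest. *)
    have : hfun (rho ^+ 2 - 1) = (rho - 1) ^+ 2 + 2 * (rho * hfun (rho - 1)).
      by rewrite !hfunE lnXn//; lra.
    have := sqr_ge0 (rho - 1).
    have : hfun (rho - 1) <= rho * hfun (rho - 1) by rewrite ler_peMl//; lra.
    move=> h1 h2 h3.
    have h4 : 2 * hfun (rho - 1) <= hfun (rho ^+ 2 - 1) by lra.
    by nra.
  have E1 : 0 < E.
    by rewrite lt_neqAle E0 andbT; apply/eqP => E00; move: Er2; rewrite -E00 mul0r; lra.
  have := @IVT R (fun z => hfun (z - 1)) rho (rho ^+ 2) (W / E) rr2
    (@hfun_continuous _ _ r0).
  have h1 : hfun (rho - 1) <= (1 - eps) * (W / E).
    by rewrite mulrA ler_pdivlMr// mulrC.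
  have WE : 0 < W / E by rewrite divr_gt0.
  have h2 : W / E <= hfun (rho ^+ 2 - 1) by rewrite ler_pdivrMr// mulrC ltW.
  case.
    by rewrite ge_min le_max h2 orbT andbT; apply/orP; left; nra.
  move=> z; rewrite in_itv/= => /andP[rz zr2] hz; exists z.
  have EW : E * hfun (z - 1) = W by rewrite hz mulrC divfK// gt_eqF.
  by split; rewrite ?hz ?EW//; [rewrite -hz EW|right; rewrite -hz].
have lr0 : 0 <= ln rho by apply: ln_ge0; lra.
have l1 : 0 < 1 + ln rho by lra.
have KA := poisson_kl_ge e0 r1 rz zr2 hz.
set c := eps ^+ 2 / 8 / (1 + ln rho).
have c0 : 0 <= c by rewrite !mulr_ge0 ?sqr_ge0 ?invr_ge0// ltW.
have c1 : c <= 1.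
  by rewrite ler_pdivrMr// mul1r; nra.
have Kc : c * hfun (z - 1) <= poisson_kl z rho.
  by rewrite /c mulrAC ler_pdivrMr.
have h0 : 0 <= hfun (rho - 1) by apply: hfun_ge0; lra.
have hz0 : 0 <= hfun (z - 1) by apply: hfun_ge0; lra.
have hrz : hfun (rho - 1) <= hfun (z - 1) by nra.
(* The error of replacing Bernoulli by Poisson moments is absorbed by one of the two copies of
   [poisson_kl z rho]; the other copy yields the gain [c]. *)
have err : eps ^+ 2 / 16 * ((rho - 1) ^+ 2 / rho ^+ 2) <= poisson_kl z rho.
  apply: le_trans Kc; apply: le_trans (ler_wpM2l c0 hrz).
  have hs := hfun_sqr_le (ltW r1).
  have lnr : 1 + ln rho <= rho by have := ln_le_subr1 r0; lra.
  have h1 : (rho - 1) ^+ 2 / rho ^+ 2 <= 2 * (hfun (rho - 1) / rho).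
    rewrite ler_pdivrMr ?exprn_gt0//.
    suff -> : 2 * (hfun (rho - 1) / rho) * rho ^+ 2 = 2 * (rho * hfun (rho - 1)) by [].
    by field; rewrite gt_eqF.
  have h2 : hfun (rho - 1) / rho <= hfun (rho - 1) / (1 + ln rho).
    by rewrite ler_wpM2l// lef_pV2.
  have e16 : 0 <= eps ^+ 2 / 16 by rewrite mulr_ge0 ?sqr_ge0.
  have -> : c * hfun (rho - 1) = eps ^+ 2 / 16 * (2 * (hfun (rho - 1) / (1 + ln rho))).
    by rewrite /c; lra.
  by apply: ler_wpM2l => //; apply: (le_trans h1); rewrite ler_wpM2l.
exists z; split=> //.
  apply: (@le_trans _ _ (E * ((1 - c) * hfun (z - 1)))).
    by apply: ler_wpM2l => //; lra.
  by rewrite mulrCA [X in _ <= X]mulrC; apply: ler_wpM2l => //; lra.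
case: EWeq => [->|EWeq]; [by left|right].
by rewrite -EWeq mulrCA; apply: ler_wpM2l.
Qed.

End Entropy.

(** * Independent edges, likelihood ratios and their cross moments *)

Section RandomGraph.
#[local] Set Implicit Arguments.
#[local] Unset Strict Implicit.
#[local] Unset Printing Implicit Defensive.
Variables (R : realType) (n : nat).
Implicit Types (p q : 'I_n -> 'I_n -> R) (C D : {set 'I_n}) (A : graph n).
Implicit Types (S : {set vpair n}) (rho : {set 'I_n} -> R).

Definition edges D : {set vpair n} :=
  [set e : vpair n | ((val e).1 \in D) && ((val e).2 \in D)].

Definition pe p (e : vpair n) : R := p (val e).1 (val e).2.

Lemma edges_inE A D : edges_in A D = (\sum_(e in edges D) A e)%N.
Proof. by apply: eq_bigl => e; rewrite inE. Qed.

Lemma edgesI C D : edges (C :&: D) = edges C :&: edges D.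
Proof. by apply/setP => e; rewrite !inE andbACA. Qed.

Lemma edgesS D C : D \subset C -> edges D \subset edges C.
Proof.
move=> /fintype.subsetP DC; apply/fintype.subsetP => e.
by rewrite !inE => /andP[/DC-> /DC->].
Qed.

Lemma edges0 : edges finset.set0 = finset.set0.
Proof. by apply/setP => e; rewrite !inE. Qed.

Lemma vpair_neq (e : vpair n) : (val e).1 != (val e).2.
Proof. by apply/eqP => h; have := valP e; rewrite h ltnn. Qed.

Lemma expect_prod p (F : vpair n -> bool -> R) :
  expect p (fun A => \prod_e F e (A e)) =
  \prod_e (pe p e * F e true + (1 - pe p e) * F e false).
Proof.
transitivity (\prod_e \sum_(b : bool) ((if b then pe p e else 1 - pe p e) * F e b)).
  rewrite (bigA_distr_bigA (fun e b => (if b then pe p e else 1 - pe p e) * F e b)).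
  by apply: eq_bigr => A _; rewrite big_split.
by apply: eq_bigr => e _; rewrite big_bool.
Qed.

Lemma expect1 p : expect p (fun=> 1) = 1.
Proof.
transitivity (expect p (fun=> \prod_(e : vpair n) 1)).
  by apply: eq_bigr => A _; rewrite big1.
by rewrite (expect_prod p (fun _ _ => 1)) big1// => e _; rewrite !mulr1 subrKC.
Qed.

Lemma mean_edgesE p D : mean_edges p D = \sum_(e in edges D) pe p e.
Proof.
transitivity (\sum_(e in edges D) expect p (fun A => (A e)%:R)).
  rewrite exchange_big; apply: eq_bigr => A _ /=.
  by rewrite edges_inE natr_sum mulr_sumr.
apply: eq_bigr => e _.
(* A single edge indicator is a product over all edges with trivial factors away from [e]. *)
have /esym := expect_prod p (fun e' b => if e' == e then b%:R else 1).
rewrite (bigD1 e)//= eqxx mulr1 mulr0 addr0 big1 => [|e' /negbTE->]; last first.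
  by rewrite !mulr1 subrKC.
rewrite mulr1 => ->; apply: eq_bigr => A _; congr (_ * _).
by rewrite (bigD1 e)//= eqxx big1 ?mulr1// => e' /negbTE->.
Qed.

(** Density, on the edges of [S], of Bernoulli laws of means [rh * pe p e] with respect to means
    [pe p e < 1]. Leaving [S] free allows the common edges of two communities to be split off. *)
Definition lratio p (rh : R) S A : R :=
  \prod_(e in S) (if A e then rh else (1 - rh * pe p e) / (1 - pe p e)).

Lemma lratioU p rh S S' A : S \subset S' ->
  lratio p rh S' A = lratio p rh S A * lratio p rh (S' :\: S) A.
Proof.
move=> SS'; rewrite /lratio (big_setID S) /=.
by move/finset.setIidPr : SS' => ->.
Qed.

Lemma edgeprob_planted p rho C A : (forall e, e \in edges C -> pe p e < 1) ->
  edgeprob (planted p rho C) A = edgeprob p A * lratio p (rho C) (edges C) A.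
Proof.
move=> p1; rewrite /edgeprob /lratio [X in _ = _ * X]big_mkcond -big_split/=.
apply: eq_bigr => e _.
have eC : (e \in edges C) = ((val e).1 \in C) && ((val e).2 \in C) by rewrite inE.
rewrite /planted; have := p1 e; rewrite eC.
case: (boolP (_ && _)) => Ce; last by rewrite mulr1.
move=> /(_ isT); rewrite /pe => pe1.
case: (A e); first by rewrite [RHS]mulrC.
by rewrite [RHS]mulrC divfK// subr_eq0 gt_eqF.
Qed.

Lemma edgeprob_ge0 p A : (forall e, 0 <= pe p e <= 1) -> 0 <= edgeprob p A.
Proof.
move=> p01; apply: prodr_ge0 => e _; have /andP[p0 p1] := p01 e.
by case: ifP => // _; rewrite subr_ge0.
Qed.

Lemma pe_planted01 p rho C e : (forall e, 0 <= pe p e <= 1) -> 0 <= rho C ->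
  (forall e, e \in edges C -> rho C * pe p e <= 1) -> 0 <= pe (planted p rho C) e <= 1.
Proof.
move=> p01 rho0 H; have /andP[p0 p1] := p01 e; rewrite /pe /planted.
case: (boolP ((_ \in _) && _)) => [eC|_]; last exact: p01.
have rp1 : rho C * pe p e <= 1 by apply: H; rewrite inE.
by apply/andP; split; [exact: mulr_ge0|exact: rp1].
Qed.

Lemma lratio_ge0 p rh S A : 0 <= rh ->
  (forall e, e \in S -> 0 <= pe p e <= 1 /\ rh * pe p e <= 1) -> 0 <= lratio p rh S A.
Proof.
move=> r0 H; apply: prodr_ge0 => e /H[/andP[p0 p1] rp1].
by case: ifP => // _; rewrite divr_ge0// subr_ge0.
Qed.

Lemma prob_le_expect p (P : pred (graph n)) (f : graph n -> R) :
  (forall e, 0 <= pe p e <= 1) -> (forall A, 0 <= f A) -> (forall A, P A -> 1 <= f A) ->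
  prob p P <= expect p f.
Proof.
move=> p01 f0 f1; rewrite /prob /expect big_mkcond; apply: ler_sum => A _.
have P0 := edgeprob_ge0 A p01.
by case: ifPn => [/f1 fA|_]; [rewrite ler_peMr|rewrite mulr_ge0].
Qed.

(* [E_0 (theta^A L^2)] for one edge of null probability [x] and likelihood ratio [L]. *)
Definition tilted_sqr (rh th x : R) := x * (rh ^+ 2 * th) + (1 - rh * x) ^+ 2 / (1 - x).

(** Separates the Poisson exponent, linear in [x], from a correction with an extra factor
    [x / (1 - x)], which smallness of [rh ^+ 2 * x] controls. *)
Lemma tilted_sqrE rh th x : x < 1 -> tilted_sqr rh th x =
  1 + x * (rh ^+ 2 * th - 2 * rh + 1 + (rh - 1) ^+ 2 * (x / (1 - x))).
Proof. by move=> x1; rewrite /tilted_sqr; field; rewrite subr_eq0 gt_eqF. Qed.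

(** The expectation factors over edges. A likelihood ratio has null mean one, so an edge in only one
    of [S1] and [S2] contributes [1]. The separate [rh] serves both squares produced by AM-GM. *)
Lemma expect_lratio_tilted p rh rh1 rh2 th S1 S2 :
  (forall e, e \in S1 :|: S2 -> pe p e < 1) ->
  expect p (fun A => lratio p rh (S1 :&: S2) A ^+ 2
     * th ^+ (\sum_(e in S1 :&: S2) A e)
     * (lratio p rh1 (S1 :\: S2) A * lratio p rh2 (S2 :\: S1) A)) =
  \prod_(e in S1 :&: S2) tilted_sqr rh th (pe p e).
Proof.
move=> p1.
pose l (rh : R) e (b : bool) := if b then rh else (1 - rh * pe p e) / (1 - pe p e).
pose F e b := if e \in S1 :&: S2 then l rh e b ^+ 2 * th ^+ b else
  if e \in S1 then l rh1 e b else if e \in S2 then l rh2 e b else 1.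
have lE rh' e : e \in S1 :|: S2 ->
    pe p e * l rh' e true + (1 - pe p e) * l rh' e false = 1.
  by move=> /p1 pe1; rewrite /l/=; field; rewrite subr_eq0 gt_eqF.
transitivity (expect p (fun A => \prod_e F e (A e))).
  apply: eq_bigr => A _; congr (_ * _).
  rewrite expr_sum -prodrXl /lratio ![\prod_(e in _) _]big_mkcond -!big_split/=.
  apply: eq_bigr => e _; rewrite /F /l !inE.
  by case: (e \in S1); case: (e \in S2); rewrite /= ?mulr1 ?mul1r.
rewrite expect_prod [RHS]big_mkcond; apply: eq_bigr => e _; rewrite /F.
have := lE^~ e; rewrite !inE.
case: (boolP (e \in S1)) => e1; case: (boolP (e \in S2)) => e2 /= le.
- rewrite /l /tilted_sqr expr1 expr0 mulr1.
  have : pe p e < 1 by apply: p1; rewrite inE e1.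
  by move=> pe1; field; rewrite subr_eq0 gt_eqF.
- exact: le.
- exact: le.
- by rewrite !mulr1 subrKC.
Qed.

(** AM-GM touches only the factors on common edges: each square then carries one scaling and one
    truncation, while the other factors stay at first power. An indicator equals its square, so it
    survives in its term and is replaced by its exponential majorant. *)
Lemma expect_lratio_pair p rh1 rh2 S1 S2 (G1 G2 : pred (graph n)) w1 w2 th1 th2 :
  (forall e, 0 <= pe p e <= 1) -> 0 <= rh1 -> 0 <= rh2 ->
  (forall e, e \in S1 -> pe p e < 1 /\ rh1 * pe p e <= 1) ->
  (forall e, e \in S2 -> pe p e < 1 /\ rh2 * pe p e <= 1) ->
  (forall A, (G1 A)%:R <= w1 * th1 ^+ (\sum_(e in S1 :&: S2) A e)) ->
  (forall A, (G2 A)%:R <= w2 * th2 ^+ (\sum_(e in S1 :&: S2) A e)) ->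
  expect p (fun A => (lratio p rh1 S1 A * (G1 A)%:R) * (lratio p rh2 S2 A * (G2 A)%:R))
  <= 2^-1 * (w1 * \prod_(e in S1 :&: S2) tilted_sqr rh1 th1 (pe p e) +
             w2 * \prod_(e in S1 :&: S2) tilted_sqr rh2 th2 (pe p e)).
Proof.
move=> p01 r10 r20 H1 H2 HG1 HG2.
have p1 e : e \in S1 :|: S2 -> pe p e < 1.
  by rewrite inE => /orP[/H1[]|/H2[]].
rewrite -(expect_lratio_tilted rh1 rh1 rh2 th1 p1) -(expect_lratio_tilted rh2 rh1 rh2 th2 p1).
rewrite /expect !mulr_sumr -big_split mulr_sumr /=; apply: ler_sum => A _.
set P := edgeprob p A; set a := lratio p rh1 (S1 :&: S2) A.
set b := lratio p rh2 (S1 :&: S2) A; set a' := lratio p rh1 (S1 :\: S2) A.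
set b' := lratio p rh2 (S2 :\: S1) A.
have -> : lratio p rh1 S1 A = a * a'.
  by rewrite (lratioU p rh1 A (subsetIl S1 S2)) finset.setDIr finset.setDv finset.set0U.
have -> : lratio p rh2 S2 A = b * b'.
  by rewrite (lratioU p rh2 A (subsetIr S1 S2)) finset.setDIr finset.setDv finset.setU0.
have P0 : 0 <= P by exact: edgeprob_ge0.
have a'0 : 0 <= a'.
  by apply: lratio_ge0 => // e; rewrite inE => /andP[_ /H1[_ ?]].
have b'0 : 0 <= b'.
  by apply: lratio_ge0 => // e; rewrite inE => /andP[_ /H2[_ ?]].
have := HG1 A; have := HG2 A.
set t1 := th1 ^+ _; set t2 := th2 ^+ _ => h2 h1.
have sq (g : bool) : (g%:R : R) ^+ 2 = g%:R by case: g; rewrite ?expr1n ?expr0n.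
have k1 := ler_wpM2l (sqr_ge0 a) h1.
have k2 := ler_wpM2l (sqr_ge0 b) h2.
have key : a * (G1 A)%:R * (b * (G2 A)%:R) <=
    2^-1 * (w1 * (a ^+ 2 * t1) + w2 * (b ^+ 2 * t2)).
  have := sqr_ge0 (a * (G1 A)%:R - b * (G2 A)%:R).
  by rewrite sqrrB !exprMn !sq; lra.
have Q0 : 0 <= P * (a' * b') by rewrite !mulr_ge0.
by have := ler_wpM2l Q0 key; lra.
Qed.

End RandomGraph.

(** * Counting communities and subsets *)

Section Counting.
#[local] Set Implicit Arguments.
#[local] Unset Strict Implicit.
#[local] Unset Printing Implicit Defensive.

(** The ratio of the two binomials is a product of factors [(r - i) / (n - i)] with [i < k], each at
    most [r / n]. *)
Lemma leq_bin_sub n r k : (k <= r <= n)%N ->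
  (n ^ k * 'C(n - k, r - k) <= r ^ k * 'C(n, r))%N.
Proof.
elim: k => [|k IH]; first by rewrite !expn0 !subn0.
move=> /andP[kr rn]; have {IH} := IH; rewrite (ltnW kr) rn => /(_ isT) IH.
have nk0 : (0 < n - k)%N by rewrite subn_gt0 (leq_trans kr).
have := mul_bin_diag (n - k) (r - k.+1); rewrite -subnS subnSK// => h.
rewrite -(leq_pmul2l nk0) expnS mulnCA -(mulnA n) (mulnCA (n - k)%N) h.
apply: (@leq_trans (n * (r - k) * (r ^ k * 'C(n, r)))).
  by rewrite -mulnA leq_mul2l mulnCA leq_mul2l IH !orbT.
rewrite expnS [X in (_ <= X)%N]mulnACA leq_mul2r; apply/orP; right.
by rewrite !mulnBr (mulnC n r) leq_sub2l// leq_mul2r rn orbT.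
Qed.

(** Removing [D] is injective on its supersets and lands in the subsets of its complement. *)
Lemma leq_card_supersets (T : finType) (D : {set T}) r :
  (#|[set C : {set T} | D \subset C & #|C| == r]| <= 'C(#|T| - #|D|, r - #|D|))%N.
Proof.
have -> : (#|T| - #|D|)%N = #|~: D| by rewrite -(cardsC D) addKn.
rewrite -cards_draws.
have inj : {in [set C : {set T} | D \subset C & #|C| == r] &,
    injective (fun C : {set T} => C :\: D)}.
  move=> C1 C2; rewrite !inE => /andP[D1 _] /andP[D2 _] h.
  by rewrite -(finset.setID C1 D) -(finset.setID C2 D) h
             (finset.setIidPr D1) (finset.setIidPr D2).
rewrite -(card_in_imset inj); apply: subset_leq_card.
apply/fintype.subsetP => X /imsetP[C]; rewrite !inE => /andP[DC /eqP Cr] ->.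
rewrite cardsD (finset.setIidPr DC) Cr eqxx andbT.
by rewrite finset.setDE finset.subsetIr.
Qed.

Variable R : realType.

(** For [k <= r] the left side is one term of the expansion of [(1 + k / r) ^ r], which is at most
    [expR k]. *)
Lemma binomial_expR_le (r k : nat) : (0 < r)%N ->
  'C(r, k)%:R * (k%:R / r%:R) ^+ k <= expR (k%:R : R).
Proof.
move=> r0; have [rk|kr] := ltnP r k; first by rewrite bin_small// mul0r expR_ge0.
have x0 : 0 <= k%:R / r%:R :> R by rewrite divr_ge0.
apply: (@le_trans _ _ ((1 + k%:R / r%:R) ^+ r)).
  have kr' : (k < r.+1)%N by [].
  rewrite exprDn (bigD1 (Ordinal kr'))//= expr1n mul1r mulr_natl lerDl.
  by apply: sumr_ge0 => i _; rewrite expr1n mul1r mulrn_wge0// exprn_ge0.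
have -> : expR (k%:R : R) = expR (k%:R / r%:R) ^+ r.
  by rewrite -expRM_natr divfK// pnatr_eq0 -lt0n.
by rewrite lerXn2r ?nnegrE ?expR_ge0 ?addr_ge0// expR_ge1Dx.
Qed.

(** Grouping by [k = #|D|] gives at most ['C(#|C|, k)] equal terms; by [binomial_expR_le] their
    number is offset by the factors [expR (- 1)] and [k / #|C|], leaving a geometric series in
    [y]. *)
Lemma sum_subsets_le (T : finType) (C : {set T}) (y : R) : 0 <= y -> y <= 1/2 ->
  \sum_(D : {set T} | (D \subset C) && (D != finset.set0))
     (y * expR (- 1) * (#|D|%:R / #|C|%:R)) ^+ #|D| <= 2 * y.
Proof.
move=> y0 y12.
(* The extra [- y ^+ m] lets the induction close when [y <= 1/2]. *)
have geo m : \sum_(1 <= k < m.+1) y ^+ k <= 2 * y * (1 - y ^+ m).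
  elim: m => [|m IH]; first by rewrite big_geq// expr0 subrr mulr0.
  rewrite big_nat_recr//= exprS; have := exprn_ge0 m y0 => ym.
  have : y * y <= y * (1 / 2) by rewrite ler_wpM2l.
  by nra.
have [C0|C0] := posnP #|C|.
  rewrite big1; first by rewrite mulr_ge0.
  move=> D /andP[]; move/eqP: C0; rewrite cards_eq0 => /eqP ->.
  by rewrite finset.subset0 => ->.
set f := fun k => (y * expR (- 1) * (k%:R / #|C|%:R)) ^+ k.
have f0 k : 0 <= f k by rewrite exprn_ge0// !mulr_ge0 ?expR_ge0.
apply: (@le_trans _ _ (\sum_(1 <= k < #|C|.+1) y ^+ k)); last first.
  by apply: (le_trans (geo _)); rewrite ler_piMr ?mulr_ge0// gerBl exprn_ge0.
apply: (@le_trans _ _ (\sum_(D : {set T} | (D \subset C) && (D != finset.set0))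
    \sum_(1 <= k < #|C|.+1) (#|D| == k)%:R * f k)).
  apply: ler_sum => D /andP[DC D0].
  have kr : #|D| \in index_iota 1 #|C|.+1.
    by rewrite mem_index_iota card_gt0 D0 ltnS subset_leq_card.
  rewrite (big_rem _ kr)/= eqxx mul1r lerDl.
  by apply: sumr_ge0 => k _; rewrite mulr_ge0.
rewrite exchange_big/=; apply: ler_sum => k _.
rewrite -mulr_suml.
apply: (@le_trans _ _ ('C(#|C|, k)%:R * f k)).
  apply: ler_wpM2r => //; rewrite -cards_draws -sum1_card natr_sum.
  rewrite [X in _ <= X]big_mkcond [X in X <= _]big_mkcond/=.
  apply: ler_sum => D _; rewrite inE.
  by case: (D \subset C); case: (D != finset.set0); case: (#|D| == k).
rewrite /f exprMn [X in _ * X]mulrC mulrA.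
apply: (@le_trans _ _ (expR k%:R * (y * expR (- 1)) ^+ k)).
  by apply: ler_wpM2r; [rewrite exprn_ge0// mulr_ge0// expR_ge0|exact: binomial_expR_le].
by rewrite exprMn -expRM_natr mulrCA -expRD mulN1r subrr expR0 mulr1.
Qed.
End Counting.

(** * From truncated moments to a lower bound on the risk *)

Section Risk.
#[local] Set Implicit Arguments.
#[local] Unset Strict Implicit.
#[local] Unset Printing Implicit Defensive.
Variables (R : realType) (n r : nat) (p : 'I_n -> 'I_n -> R) (rho : {set 'I_n} -> R).
Hypotheses (p01 : forall e : vpair n, 0 <= pe p e <= 1) (rn : (r <= n)%N).
Implicit Types (C D : {set 'I_n}) (A : graph n).

Lemma le_maxC (f : {set 'I_n} -> R) C : #|C| = r -> f C <= Defs.maxC r f.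
Proof. by move=> /eqP Cr; rewrite /Defs.maxC; exact: le_bigmax_cond. Qed.

Lemma prob_complement (q : 'I_n -> 'I_n -> R) (P : pred (graph n)) :
  prob q P + prob q (predC P) = 1.
Proof.
rewrite -(expect1 q) /expect /prob [RHS](bigID P) /=.
by congr (_ + _); apply: eq_bigr => A _; rewrite mulr1.
Qed.

(** The two kinds of error are then complementary events under one and the same law. *)
Lemma risk_ge1_of_eq psi C : #|C| = r ->
  (forall e : vpair n, planted p rho C (val e).1 (val e).2 = pe p e) ->
  1 <= risk p rho r psi.
Proof.
move=> Cr pC; rewrite /risk.
apply: le_trans (lerD (lexx _) (le_maxC _ Cr)).
have -> : prob (planted p rho C) (fun A => psi A != true) =
    prob p (predC (fun A => psi A != false)).
  rewrite /prob; apply: eq_big => [A|A _]; first by rewrite /=; case: (psi A).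
  by apply: eq_bigr => e _; rewrite pC.
by rewrite prob_complement.
Qed.

Hypothesis planted01 : forall C, #|C| = r -> 1 < rho C /\
  forall e, e \in edges C -> pe p e < 1 /\ rho C * pe p e <= 1.

Let N : R := #|[set C : {set 'I_n} | #|C| == r]%SET|%:R.

Let N_gt0 : 0 < N.
Proof. by rewrite /N ltr0n card_draws card_ord bin_gt0. Qed.

Let Ninv_ge0 : 0 <= N^-1.
Proof. by rewrite invr_ge0 ltW. Qed.

Lemma edgeprob_planted_ge0 C A : #|C| = r -> 0 <= edgeprob (planted p rho C) A.
Proof.
move=> Cr; have [r1 H] := planted01 Cr; apply: edgeprob_ge0 => e.
by apply: pe_planted01 => [//||e' /H[]//]; lra.
Qed.

Lemma average_le_max (f : {set 'I_n} -> R) :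
  N^-1 * \sum_(C : {set 'I_n} | #|C| == r) f C <= Defs.maxC r f.
Proof.
rewrite ler_pdivrMl//.
apply: (@le_trans _ _ (\sum_(C : {set 'I_n} | #|C| == r) Defs.maxC r f)).
  by apply: ler_sum => C /eqP; exact: le_maxC.
by rewrite big_const iter_addr_0 -[X in X <= _]mulr_natl /N cardsE.
Qed.

Lemma sum_supersets_le D : (#|D| <= r)%N -> (0 < n)%N ->
  N^-1 * \sum_(C : {set 'I_n} | #|C| == r) (D \subset C)%:R <= (r%:R / n%:R) ^+ #|D|.
Proof.
move=> Dr n0; rewrite ler_pdivrMl//.
have -> : \sum_(C : {set 'I_n} | #|C| == r) (D \subset C)%:R =
    #|[set C : {set 'I_n} | D \subset C & #|C| == r]|%:R :> R.
  rewrite -sum1_card natr_sum [LHS]big_mkcond [RHS]big_mkcond/=.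
  by apply: eq_bigr => C _; rewrite inE; case: (D \subset C); case: eqP.
have nk : 0 < n%:R ^+ #|D| :> R by rewrite exprn_gt0// ltr0n.
rewrite expr_div_n mulrA ler_pdivlMr// mulrC [X in _ <= X]mulrC /N.
rewrite -!natrX -!natrM ler_nat card_draws card_ord.
apply: leq_trans (leq_bin_sub (n := n) (r := r) (k := #|D|) _); last by rewrite Dr rn.
by have := leq_card_supersets D r; rewrite card_ord leq_mul2l => ->; rewrite orbT.
Qed.

(* The indicator of [e(D) <= z C D] is dominated by [w C D * th C D ^ e(D)], which
   keeps the truncated second moments products over the edges. *)
Variables (z th w : {set 'I_n} -> {set 'I_n} -> R) (tau : {set 'I_n} -> R) (eta : R).
Hypothesis n_gt0 : (0 < n)%N.
Hypothesis tilt : forall C D, #|C| = r -> D \subset C -> [/\ 0 <= th C D, 0 <= w C D &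
  forall m : nat, m%:R <= z C D -> 1 <= w C D * th C D ^+ m].
Hypothesis w0 : forall C, w C finset.set0 = 1.
Hypothesis second_moment : forall C D, #|C| = r -> D \subset C -> D != finset.set0 ->
  (r%:R / n%:R) ^+ #|D| *
    (w C D * \prod_(e in edges D) tilted_sqr (rho C) (th C D) (pe p e)) <= tau D.
Hypothesis tail : forall C D, #|C| = r -> D \subset C -> D != finset.set0 ->
  prob (planted p rho C) (fun A => z C D < (edges_in A D)%:R) <= tau D.
Hypothesis tau_sum : forall C, #|C| = r ->
  \sum_(D : {set 'I_n} | (D \subset C) && (D != finset.set0)) tau D <= eta.

Let good C A := [forall D : {set 'I_n},
  (D \subset C) && (D != finset.set0) ==> ((edges_in A D)%:R <= z C D)].

Let L C A : R := lratio p (rho C) (edges C) A * (good C A)%:R.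

Let Lbar A : R := N^-1 * \sum_(C : {set 'I_n} | #|C| == r) L C A.

(** Bound on the truncated second moment over the edges inside [D], for the single community [C]. *)
Let g C D : R := w C D * \prod_(e in edges D) tilted_sqr (rho C) (th C D) (pe p e).

Let L_ge0 C A : #|C| = r -> 0 <= L C A.
Proof.
move=> Cr; have [r1 H] := planted01 Cr; rewrite mulr_ge0//.
by apply: lratio_ge0 => [|e /H[_ ?]]; [lra|].
Qed.

Let g_ge0 C D : #|C| = r -> D \subset C -> 0 <= g C D.
Proof.
move=> Cr DC; have [t0 w_ge0 _] := tilt Cr DC; rewrite mulr_ge0//.
have [r1 H] := planted01 Cr; apply: prodr_ge0 => e /(fintype.subsetP (edgesS DC))/H[p1 _].
have /andP[p0 _] := p01 e.
apply: addr_ge0; first by rewrite mulr_ge0// mulr_ge0// sqr_ge0.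
by rewrite divr_ge0 ?sqr_ge0// subr_ge0 ltW.
Qed.

(** A change of measure turns the null mean of the truncated ratio into the planted probability of
    [good C]; a union bound over [D] controls the complement. *)
Let expect_L C : #|C| = r -> 1 - eta <= expect p (L C).
Proof.
move=> Cr; have [r1 H] := planted01 Cr.
have -> : expect p (L C) = prob (planted p rho C) (good C).
  rewrite /expect /prob [RHS]big_mkcond/=; apply: eq_bigr => A _.
  rewrite (edgeprob_planted rho A (fun e eC => (H e eC).1)) mulrA.
  by case: (good C A); rewrite ?mulr1 ?mulr0.
rewrite -(prob_complement (planted p rho C) (good C)) lerBlDr lerD2l.
apply: le_trans (tau_sum Cr).
apply: (@le_trans _ _ (\sum_(D : {set 'I_n} | (D \subset C) && (D != finset.set0))
    prob (planted p rho C) (fun A => z C D < (edges_in A D)%:R))); last first.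
  by apply: ler_sum => D /andP[]; exact: tail.
rewrite /prob [X in _ <= X](_ : _ = \sum_(A : graph n)
    \sum_(D : {set 'I_n} | (D \subset C) && (D != finset.set0))
     (if z C D < (edges_in A D)%:R then edgeprob (planted p rho C) A else 0)); last first.
  by rewrite exchange_big/=; apply: eq_bigr => D _; rewrite big_mkcond.
rewrite big_mkcond; apply: ler_sum => A _; have P0 := edgeprob_planted_ge0 A Cr.
case: ifPn => [|_]; last by apply: sumr_ge0 => D _; case: ifP.
rewrite /= /good negb_forall => /existsP[D]; rewrite negb_imply -ltNge => /andP[DC zD].
rewrite (bigD1 D)//= zD lerDl.
by apply: sumr_ge0 => D' _; case: ifP.
Qed.

Let expect_Lbar : 1 - eta <= expect p Lbar.
Proof.
have -> : expect p Lbar = N^-1 * \sum_(C : {set 'I_n} | #|C| == r) expect p (L C).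
  rewrite exchange_big mulr_sumr; apply: eq_bigr => A _.
  by rewrite -mulr_sumr mulrCA.
rewrite ler_pdivlMl//.
apply: (@le_trans _ _ (\sum_(C : {set 'I_n} | #|C| == r) (1 - eta))).
  by rewrite big_const iter_addr_0 -mulr_natl /N cardsE.
by apply: ler_sum => C /eqP; exact: expect_L.
Qed.

Let expect_pair C1 C2 : #|C1| = r -> #|C2| = r ->
  expect p (fun A => L C1 A * L C2 A) <=
  2^-1 * (g C1 (C1 :&: C2) + g C2 (C1 :&: C2)).
Proof.
move=> C1r C2r; have [r1 H1] := planted01 C1r; have [r2 H2] := planted01 C2r.
rewrite /g edgesI.
have good_le C A : #|C| = r -> C1 :&: C2 \subset C ->
    (good C A)%:R <= w C (C1 :&: C2) * th C (C1 :&: C2) ^+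
      (\sum_(e in edges C1 :&: edges C2) A e).
  move=> Cr DC; have [t0 w_ge0 ht] := tilt Cr DC.
  case: (boolP (good C A)) => [/forallP/(_ (C1 :&: C2))|_]; last first.
    by rewrite mulr_ge0// exprn_ge0.
  (* [good] says nothing about the empty overlap; there [w] is [1] and no edge is counted, so the
     majorant is [1]. *)
  rewrite DC -edgesI -edges_inE /=; have [->|D0 /= hz] := eqVneq (C1 :&: C2) finset.set0.
    by rewrite w0 edges_inE edges0 big_set0 mulr1.
  exact: ht.
apply: (expect_lratio_pair (G1 := good C1) (G2 := good C2)) => //; [lra|lra| |].
- by move=> A; rewrite good_le// finset.subsetIl.
- by move=> A; rewrite good_le// finset.subsetIr.
Qed.

(** The event [C :&: C2 = D] is relaxed to [D \subset C2], whose probability is at most the factor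
    [(r / n) ^ |D|] of [second_moment]. Empty overlaps account for the leading [1]. *)
Let average_g C : #|C| = r ->
  N^-1 * \sum_(C2 : {set 'I_n} | #|C2| == r) g C (C :&: C2) <= 1 + eta.
Proof.
move=> Cr; rewrite ler_pdivrMl//.
apply: (@le_trans _ _ (\sum_(C2 : {set 'I_n} | #|C2| == r) (1 +
   \sum_(D : {set 'I_n} | (D \subset C) && (D != finset.set0)) g C D * (D \subset C2)%:R))).
  apply: ler_sum => C2 _; have IC := finset.subsetIl C C2.
  have [->|D0] := eqVneq (C :&: C2) finset.set0.
    rewrite /g w0 edges0 big_set0 mulr1 lerDl.
    by apply: sumr_ge0 => D /andP[DC _]; rewrite mulr_ge0// g_ge0.
  rewrite (bigD1 (C :&: C2)) ?IC//= finset.subsetIr mulr1 addrCA lerDl addr_ge0//.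
  by apply: sumr_ge0 => D /andP[/andP[DC _] _]; rewrite mulr_ge0// g_ge0.
rewrite big_split/= big_const iter_addr_0 mulrDr mulr1 lerD//.
  by rewrite /N cardsE.
rewrite exchange_big/= -ler_pdivrMl// mulr_sumr; apply: le_trans (tau_sum Cr).
apply: ler_sum => D /andP[DC D0]; apply: le_trans (second_moment Cr DC D0).
rewrite -mulr_sumr mulrCA [X in _ <= X]mulrC; apply: ler_wpM2l; first exact: g_ge0.
by apply: sum_supersets_le => //; rewrite -Cr subset_leq_card.
Qed.

Let expect_Lbar_sqr : expect p (fun A => Lbar A ^+ 2) <= 1 + eta.
Proof.
have -> : expect p (fun A => Lbar A ^+ 2) = N^-1 * (N^-1 *
   \sum_(C1 : {set 'I_n} | #|C1| == r) \sum_(C2 : {set 'I_n} | #|C2| == r)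
     expect p (fun A => L C1 A * L C2 A)).
  rewrite mulrA.
  under eq_bigr => C1 _ do rewrite exchange_big/=.
  rewrite exchange_big mulr_sumr; apply: eq_bigr => A _ /=.
  under eq_bigr => C1 _ do rewrite -mulr_sumr -mulr_sumr.
  by rewrite -mulr_sumr -mulr_suml /Lbar; lra.
have sym : \sum_(C1 : {set 'I_n} | #|C1| == r) \sum_(C2 : {set 'I_n} | #|C2| == r)
     g C2 (C1 :&: C2) =
   \sum_(C1 : {set 'I_n} | #|C1| == r) \sum_(C2 : {set 'I_n} | #|C2| == r)
     g C1 (C1 :&: C2).
  rewrite exchange_big/=; apply: eq_bigr => C1 _; apply: eq_bigr => C2 _.
  by rewrite finset.setIC.
rewrite ler_pdivrMl// mulr_sumr.
apply: (@le_trans _ _ (\sum_(C : {set 'I_n} | #|C| == r) (1 + eta))); last first.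
  by rewrite big_const iter_addr_0 -[X in X <= _]mulr_natl /N cardsE.
apply: (@le_trans _ _ (\sum_(C1 : {set 'I_n} | #|C1| == r)
   N^-1 * \sum_(C2 : {set 'I_n} | #|C2| == r) g C1 (C1 :&: C2))); last first.
  by apply: ler_sum => C /eqP; exact: average_g.
rewrite -!mulr_sumr ler_wpM2l//.
apply: (@le_trans _ _ (\sum_(C1 : {set 'I_n} | #|C1| == r)
   \sum_(C2 : {set 'I_n} | #|C2| == r) 2^-1 * (g C1 (C1 :&: C2) + g C2 (C1 :&: C2)))).
  by apply: ler_sum => C1 /eqP C1r; apply: ler_sum => C2 /eqP; exact: expect_pair.
under eq_bigr => C1 _ do rewrite -mulr_sumr big_split/=.
by rewrite -mulr_sumr big_split/= sym; lra.
Qed.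

(** A quadratic in [1 - x] lies below [min 1 x], so only two moments of [Lbar] enter: [E_0 (1 -
    Lbar)^2 <= 1 - 2 (1 - eta) + (1 + eta) = 3 eta]. The parameter [s] is left free for
    balancing. *)
Lemma risk_ge psi s : 0 < s -> 1 - s / 2 - 3 * eta / (2 * s) <= risk p rho r psi.
Proof.
move=> s0.
(* The maximum over communities dominates the average, and cutting the likelihood ratio down to
   [good C] only lowers it. *)
have avg : prob p (fun A => psi A != false) +
    \sum_(A : graph n | psi A != true) edgeprob p A * Lbar A <= risk p rho r psi.
  rewrite lerD2l; apply: le_trans (average_le_max _).
  rewrite /prob exchange_big/= mulr_sumr; apply: ler_sum => A _.
  rewrite /Lbar mulrCA ler_wpM2l//.
  rewrite mulr_sumr; apply: ler_sum => C /eqP Cr.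
  have [r1 H] := planted01 Cr.
  rewrite (edgeprob_planted rho A (fun e eC => (H e eC).1)).
  rewrite ler_wpM2l ?edgeprob_ge0// ler_piMr ?lern1 ?leq_b1//.
  by apply: lratio_ge0 => [|e /H[_ ?]]; [lra|].
apply: le_trans avg.
have Lbar_quad x : 0 <= x -> 1 - s / 2 - (1 - x) ^+ 2 / (2 * s) <= Num.min 1 x.
  move=> x0; have s2 : 0 < 2 * s by lra.
  rewrite le_min; apply/andP; split; rewrite -subr_ge0.
    have : 0 <= (1 - x) ^+ 2 / (2 * s) by rewrite divr_ge0 ?sqr_ge0// ltW.
    by lra.
  have -> : x - (1 - s / 2 - (1 - x) ^+ 2 / (2 * s)) = (1 - x - s) ^+ 2 / (2 * s).
    by field; rewrite gt_eqF.
  by rewrite divr_ge0 ?sqr_ge0// ltW.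
apply: (@le_trans _ _ (expect p (fun A => 1 - s / 2 - (1 - Lbar A) ^+ 2 / (2 * s)))).
  have -> : expect p (fun A => 1 - s / 2 - (1 - Lbar A) ^+ 2 / (2 * s)) =
     (1 - s / 2 - (2 * s)^-1) * expect p (fun=> 1) + s^-1 * expect p Lbar
     - (2 * s)^-1 * expect p (fun A => Lbar A ^+ 2).
    rewrite /expect !mulr_sumr -big_split -sumrB; apply: eq_bigr => A _ /=.
    by field; rewrite gt_eqF.
  rewrite expect1 mulr1.
  have s1 : 0 <= s^-1 by rewrite invr_ge0 ltW.
  have := ler_wpM2l s1 expect_Lbar; have := ler_wpM2l s1 expect_Lbar_sqr.
  have -> : 3 * eta / (2 * s) = 3 / 2 * eta * s^-1 by field; rewrite gt_eqF.
  have -> : (2 * s)^-1 = 2^-1 * s^-1 by field; rewrite gt_eqF.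
  by lra.
have Lbar0 A : 0 <= Lbar A.
  rewrite mulr_ge0//.
  by apply: sumr_ge0 => C /eqP; exact: L_ge0.
rewrite /expect /prob (bigID (fun A => psi A != false))/= lerD//.
  apply: ler_sum => A _; rewrite ler_piMr ?edgeprob_ge0//.
  by apply: (le_trans (Lbar_quad _ (Lbar0 A))); rewrite ge_min lexx.
rewrite [X in _ <= X](eq_bigl (fun A => ~~ (psi A != false))); last first.
  by move=> A; case: (psi A).
apply: ler_sum => A _; rewrite ler_wpM2l ?edgeprob_ge0//.
by apply: (le_trans (Lbar_quad _ (Lbar0 A))); rewrite ge_min lexx orbT.
Qed.

End Risk.

(** * Truncation level and tilt for one pair [D \subset C] *)

Section Truncation.
#[local] Set Implicit Arguments.
#[local] Unset Strict Implicit.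
#[local] Unset Printing Implicit Defensive.
Variables (R : realType) (n : nat) (p : 'I_n -> 'I_n -> R) (rho : {set 'I_n} -> R).
Variables (C D : {set 'I_n}) (kap : R).
Hypotheses (p01 : forall e : vpair n, 0 <= pe p e <= 1) (DC : D \subset C).
Hypotheses (rho1 : 1 < rho C) (plantedC : forall e, e \in edges C ->
  [/\ pe p e < 1, rho C * pe p e <= 1 & rho C ^+ 2 * (pe p e / (1 - pe p e)) <= kap]).

Lemma prod_le_expR (f g : vpair n -> R) (S : {set vpair n}) :
  (forall e, e \in S -> 0 <= 1 + f e) -> (forall e, e \in S -> f e <= g e) ->
  \prod_(e in S) (1 + f e) <= expR (\sum_(e in S) g e).
Proof.
move=> f0 fg; rewrite expR_sum; apply: ler_prod => e eS; rewrite f0//=.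
by apply: (le_trans (expR_ge1Dx _)); rewrite ler_expR fg.
Qed.

(** Applies [1 + x <= expR x] to each factor. The correction is kept proportional to
    [(rho C - 1) ^+ 2 / rho C ^+ 2] so that it remains comparable with the entropy as [rho C]
    approaches [1]. *)
Lemma prod_tilted_sqr_le th : 0 <= th ->
  \prod_(e in edges D) tilted_sqr (rho C) th (pe p e) <=
  expR (mean_edges p D * (rho C ^+ 2 * th - 2 * rho C + 1
                          + kap * ((rho C - 1) ^+ 2 / rho C ^+ 2))).
Proof.
move=> th0; have r0 : 0 < rho C by exact: lt_trans rho1.
have sub := fintype.subsetP (edgesS DC).
pose f e := pe p e * (rho C ^+ 2 * th - 2 * rho C + 1
   + (rho C - 1) ^+ 2 * (pe p e / (1 - pe p e))).
rewrite (eq_bigr (fun e => 1 + f e)); last first.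
  by move=> e /sub/plantedC[p1 _ _]; rewrite tilted_sqrE.
rewrite mean_edgesE mulr_suml; apply: prod_le_expR => e /sub/plantedC[p1 _ hk].
  have /andP[p0 _] := p01 e.
  rewrite /f -tilted_sqrE//; apply: addr_ge0; first by rewrite mulr_ge0// mulr_ge0// sqr_ge0.
  by rewrite divr_ge0 ?sqr_ge0// subr_ge0 ltW.
have /andP[p0 _] := p01 e.
rewrite /f; apply: ler_wpM2l => //; rewrite lerD2l [X in _ <= X]mulrCA; apply: ler_wpM2l.
  exact: sqr_ge0.
by rewrite ler_pdivlMr ?exprn_gt0// mulrC.
Qed.

(** Markov's inequality for [t ^ e(D)], whose planted mean has a factor
    [1 + rho C * pe p e * (t - 1)] per edge. *)
Lemma chernoff_planted (t x : R) : 1 <= t ->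
  prob (planted p rho C) (fun A => x < (edges_in A D)%:R) <=
  expR (mean_edges p D * (rho C * (t - 1)) - x * ln t).
Proof.
move=> t1; have t0 : 0 < t by lra.
have r1 := rho1.
have sub := fintype.subsetP (edgesS DC).
pose F (e : vpair n) (b : bool) := if e \in edges D then t ^+ b else 1.
apply: (@le_trans _ _ (expect (planted p rho C)
    (fun A => expR (- (x * ln t)) * \prod_e F e (A e)))).
  have FE (A : graph n) : \prod_e F e (A e) = expR ((edges_in A D)%:R * ln t).
    rewrite -big_mkcond/= -expr_sum -edges_inE -{1}(lnK (x := t)) ?posrE//.
    by rewrite -expRM_natr mulrC.
  apply: prob_le_expect.
    by move=> e; apply: pe_planted01 => [//||e' /plantedC[]//]; lra.
    by move=> A; rewrite FE mulr_ge0 ?expR_ge0.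
  move=> A /= xA; rewrite FE -expRD leNgt expR_lt1 -leNgt.
  by have := ler_wpM2r (ln_ge0 t1) (ltW xA); lra.
have -> : expect (planted p rho C) (fun A => expR (- (x * ln t)) * \prod_e F e (A e)) =
   expR (- (x * ln t)) * expect (planted p rho C) (fun A => \prod_e F e (A e)).
  by rewrite /expect mulr_sumr; apply: eq_bigr => A _; rewrite mulrCA.
rewrite expect_prod addrC expRD; apply: ler_wpM2l; first exact: expR_ge0.
rewrite (eq_bigr (fun e => if e \in edges D then 1 + pe p e * (rho C * (t - 1)) else 1)).
  rewrite -big_mkcond mean_edgesE mulr_suml; apply: prod_le_expR => // e eD.
  have /andP[p0 _] := p01 e.
  by rewrite addr_ge0// mulr_ge0// mulr_ge0; lra.
move=> e _; rewrite /F; case: ifPn => eD; last by rewrite !mulr1 subrKC.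
have -> : pe (planted p rho C) e = rho C * pe p e.
  by have := sub e eD; rewrite inE /pe /planted => ->.
by rewrite expr1 expr0; lra.
Qed.

Lemma prob_edges_in_gt_card :
  prob (planted p rho C) (fun A => #|{: vpair n}|%:R < (edges_in A D)%:R :> R) = 0.
Proof.
rewrite /prob big_pred0// => A; apply/negbTE; rewrite -leNgt ler_nat edges_inE.
rewrite -sum1_card big_mkcond/=; apply: leq_sum => e _.
by case: ifP => // _; exact: leq_b1.
Qed.

Lemma truncation_none : exists z th w : R, [/\ 0 <= th, 0 <= w,
  forall m : nat, m%:R <= z -> 1 <= w * th ^+ m,
  w * \prod_(e in edges D) tilted_sqr (rho C) th (pe p e) <=
    expR (mean_edges p D * ((rho C - 1) ^+ 2 + kap * ((rho C - 1) ^+ 2 / rho C ^+ 2))) &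
  prob (planted p rho C) (fun A => z < (edges_in A D)%:R) = 0].
Proof.
(* The number of all pairs is a threshold that is never exceeded. *)
exists #|{: vpair n}|%:R, 1, 1; split=> //.
- by move=> m _; rewrite expr1n mulr1.
- rewrite mul1r; apply: le_trans (prod_tilted_sqr_le ler01) _.
  by rewrite (_ : rho C ^+ 2 * 1 - 2 * rho C + 1 = (rho C - 1) ^+ 2)//; lra.
- exact: prob_edges_in_gt_card.
Qed.

Lemma truncation_exists eps W : 0 < eps -> eps <= 1/2 -> 0 < W -> kap = eps ^+ 2 / 16 ->
  mean_edges p D * hfun (rho C - 1) <= (1 - eps) * W ->
  exists z th w : R, [/\ 0 <= th, 0 <= w,
  forall m : nat, m%:R <= z -> 1 <= w * th ^+ m,
  w * \prod_(e in edges D) tilted_sqr (rho C) th (pe p e) <=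
    expR (W * (1 - eps ^+ 2 / 8 / (1 + ln (rho C)))) &
  prob (planted p rho C) (fun A => z < (edges_in A D)%:R) <=
    expR (- (eps ^+ 2 / 8 / (1 + ln (rho C)) * W))].
Proof.
move=> e0 e12 W0 kapE hE; have r0 : 0 < rho C by exact: lt_trans rho1.
have E0 : 0 <= mean_edges p D.
  by rewrite mean_edgesE; apply: sumr_ge0 => e _; case/andP: (p01 e).
have r1 := rho1; have [y [ry yr2 hy]] := tilt_exists e0 e12 rho1 E0 W0 hE.
(* At [y = rho C ^+ 2] the tilt is trivial: [hfun (y - 1) - 2 * poisson_kl y (rho C)] is the
   untruncated exponent [(rho C - 1) ^+ 2]. *)
rewrite -kapE in hy; case=> [yE|tailW].
  have [z [th [w [th0 w0 h1 h2 h3]]]] := truncation_none.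
  exists z, th, w; split=> //; last by rewrite h3 expR_ge0.
  apply: (le_trans h2); rewrite ler_expR; apply: le_trans hy.
  rewrite yE /poisson_kl hfunE lnXn//.
  by apply: ler_wpM2l => //; rewrite -mulr_natl; lra.
have y0 : 0 < y by lra.
have th0 : 0 < y / rho C ^+ 2 by rewrite divr_gt0 ?exprn_gt0.
have lnth : ln (y / rho C ^+ 2) = ln y - 2 * ln (rho C).
  by rewrite ln_div ?posrE ?exprn_gt0// lnXn// mulr_natl.
(* The weight is the tilt raised to minus the threshold; as the tilt is at most [1], the majorant is
   at least [1] for counts up to the threshold. *)
exists (y * mean_edges p D), (y / rho C ^+ 2),
  (expR (- (y * mean_edges p D * ln (y / rho C ^+ 2)))); split=> //.
- exact: ltW.
- move=> m hm; rewrite -{2}(lnK (x := y / rho C ^+ 2)) ?posrE//.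
  rewrite -expRM_natr -expRD leNgt expR_lt1 -leNgt.
  have : ln (y / rho C ^+ 2) <= 0.
    by apply: ln_le0; rewrite ler_pdivrMr ?exprn_gt0// mul1r.
  by move=> l0; have := ler_wnM2r l0 hm; lra.
- have := prod_tilted_sqr_le (ltW th0).
  move/(ler_wpM2l (expR_ge0 (- (y * mean_edges p D * ln (y / rho C ^+ 2))))).
  move/le_trans; apply; rewrite -expRD ler_expR; apply: le_trans hy.
  rewrite lnth mulrCA mulfV ?gt_eqF ?exprn_gt0// mulr1 /poisson_kl hfunE.
  by lra.
(* The Chernoff exponent is smallest at [t = y / rho C], where it equals
   [- mean_edges p D * poisson_kl y (rho C)]. *)
- have yr1 : 1 <= y / rho C by rewrite ler_pdivlMr// mul1r.
  apply: (le_trans (chernoff_planted _ yr1)); rewrite ler_expR.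
  have -> : rho C * (y / rho C - 1) = y - rho C by field; rewrite gt_eqF.
  by move: tailW; rewrite ln_div ?posrE// /poisson_kl; lra.
Qed.

End Truncation.

(** * Tilts for all pairs and summation over [D] *)

Section Regimes.
#[local] Set Implicit Arguments.
#[local] Unset Strict Implicit.
#[local] Unset Printing Implicit Defensive.
Variables (R : realType) (n r : nat) (p : 'I_n -> 'I_n -> R) (rho : {set 'I_n} -> R).
Implicit Types (C D : {set 'I_n}).
Hypotheses (p01 : forall e : vpair n, 0 <= pe p e <= 1) (r_gt0 : (0 < r)%N) (rn : (r < n)%N).
Variables (eps y : R).
Hypotheses (eps0 : 0 < eps) (eps12 : eps <= 1/2) (y0 : 0 < y) (y12 : y <= 1/2).
Hypothesis plantedC : forall C, #|C| = r -> 1 < rho C /\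
  forall e, e \in edges C -> [/\ pe p e < 1, rho C * pe p e <= 1 &
    rho C ^+ 2 * (pe p e / (1 - pe p e)) <= eps ^+ 2 / 16].
Hypothesis budget : forall C D, #|C| = r -> D \subset C -> D != finset.set0 ->
  mean_edges p D * hfun (rho C - 1) <= (1 - eps) * (#|D|%:R * ln (n%:R / #|D|%:R)).
Hypothesis regime : forall C D, #|C| = r -> D \subset C -> D != finset.set0 ->
  2 * ln (r%:R / #|D|%:R) + (1 - ln y) <=
    eps ^+ 2 / 8 / (1 + ln (rho C)) * ln (n%:R / #|D|%:R) \/
  mean_edges p D * ((rho C - 1) ^+ 2 * (1 + eps ^+ 2 / 16)) <=
    #|D|%:R * (ln (n%:R / r%:R) + ln (#|D|%:R / r%:R) - (1 - ln y)).

(** Common target for second moments and tails, of the form that [sum_subsets_le] sums to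
    [2 * y]. *)
Let tau D : R := (y * expR (- 1) * (#|D|%:R / r%:R)) ^+ #|D|.

Let exprn_expR (x : R) k : 0 < x -> x ^+ k = expR (k%:R * ln x).
Proof. by move=> x0; rewrite mulrC expRM_natr lnK. Qed.

(** The estimates are required only for nonempty [D] inside a community, so that a triple exists for
    every pair and [choice] yields total functions. *)
Let data C D (t : R * R * R) := let: (z, th, w) := t in
  [/\ [/\ 0 <= th, 0 <= w & forall m : nat, m%:R <= z -> 1 <= w * th ^+ m],
      D = finset.set0 -> w = 1 &
      #|C| = r -> D \subset C -> D != finset.set0 ->
      (r%:R / n%:R) ^+ #|D| *
        (w * \prod_(e in edges D) tilted_sqr (rho C) th (pe p e)) <= tau D /\
      prob (planted p rho C) (fun A => z < (edges_in A D)%:R) <= tau D].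

Let data_exists C D : exists t, data C D t.
Proof.
have trivial_data : ~ [/\ #|C| = r, D \subset C & D != finset.set0] -> data C D (0, 1, 1).
  move=> nCD; split=> //; last by move=> ? ? ?; exfalso; apply: nCD; split.
  by split=> // m _; rewrite expr1n mulr1.
have [Cr|nC] := pselect (#|C| = r); last by exists (0, 1, 1); apply: trivial_data => -[].
have [DC|nDC] := boolP (D \subset C); last first.
  by exists (0, 1, 1); apply: trivial_data => -[_]; rewrite (negbTE nDC).
have [D0|D0] := eqVneq D finset.set0.
  by exists (0, 1, 1); apply: trivial_data => -[_ _]; rewrite D0 eqxx.
have [r1 HC] := plantedC Cr.
have k0 : (0 < #|D|)%N by rewrite card_gt0.
have kr : (#|D| <= r)%N by rewrite -Cr subset_leq_card.
have [n0' r0' k0'] : [/\ 0 < n%:R :> R, 0 < r%:R :> R & 0 < #|D|%:R :> R].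
  by rewrite !ltr0n (leq_ltn_trans _ rn).
have lnkr : ln (#|D|%:R / r%:R) = - ln (r%:R / #|D|%:R) :> R.
  by rewrite !ln_div ?posrE// opprB.
have lnnr : ln (n%:R / r%:R) = ln (n%:R / #|D|%:R) - ln (r%:R / #|D|%:R) :> R.
  by rewrite !ln_div ?posrE//; lra.
have rnE : (r%:R / n%:R) ^+ #|D| = expR (- (#|D|%:R * ln (n%:R / r%:R))) :> R.
  rewrite exprn_expR ?divr_gt0//; congr expR.
  by rewrite !ln_div ?posrE//; lra.
have tauE : tau D = expR (#|D|%:R * (ln y - 1 + ln (#|D|%:R / r%:R))).
  rewrite /tau exprn_expR ?mulr_gt0 ?expR_gt0 ?invr_gt0//; congr expR.
  by rewrite !lnM ?posrE ?mulr_gt0 ?expR_gt0 ?invr_gt0// expRK.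
have W0 : 0 < #|D|%:R * ln (n%:R / #|D|%:R) :> R.
  rewrite mulr_gt0// ln_gt0// ltr_pdivlMr// mul1r ltr_nat.
  exact: leq_ltn_trans kr rn.
have lrk0 : 0 <= ln (r%:R / #|D|%:R) :> R.
  by rewrite ln_ge0// ler_pdivlMr// mul1r ler_nat.
have [large|small] := regime Cr DC D0.
  have [z [th [w [th0 w0 h1 h2 h3]]]] :=
    truncation_exists p01 DC r1 HC eps0 eps12 W0 erefl (budget Cr DC D0).
  exists (z, th, w); split=> //; first by move/eqP: D0.
  move=> _ _ _; split.
    apply: (@le_trans _ _ ((r%:R / n%:R) ^+ #|D| * expR (#|D|%:R * ln (n%:R / #|D|%:R)
       * (1 - eps ^+ 2 / 8 / (1 + ln (rho C)))))).
      by apply: ler_wpM2l => //; rewrite exprn_ge0// divr_ge0// ltW.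
    (* With [k = #|D|], the exponents [k * ln (n / k)] and [- k * ln (n / r)] leave one
       [k * ln (r / k)], and [tau D] demands a second: hence the [2] in [regime]. *)
    rewrite rnE tauE -expRD ler_expR lnkr lnnr.
    by have := ler_wpM2l (ltW k0') large; lra.
  apply: (le_trans h3); rewrite tauE ler_expR lnkr.
  have := ler_wpM2l (ltW k0') large; have := mulr_ge0 (ltW k0') lrk0; lra.
have [z [th [w [th0 w0 h1 h2 h3]]]] := truncation_none p01 DC r1 HC.
exists (z, th, w); split=> //; first by move/eqP: D0.
move=> _ _ _; split; last by rewrite h3 tauE expR_ge0.
apply: (@le_trans _ _ ((r%:R / n%:R) ^+ #|D| * expR (mean_edges p D *
    ((rho C - 1) ^+ 2 * (1 + eps ^+ 2 / 16))))).
  apply: ler_wpM2l; first by rewrite exprn_ge0// divr_ge0// ltW.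
  apply: (le_trans h2); rewrite ler_expR; apply: ler_wpM2l.
    by rewrite mean_edgesE; apply: sumr_ge0 => e _; case/andP: (p01 e).
  rewrite mulrDr mulr1 lerD2l mulrC ler_wpM2r//.
    by rewrite mulr_ge0 ?sqr_ge0.
  rewrite ler_pdivrMr ?exprn_gt0//; last by lra.
  by rewrite ler_peMr ?sqr_ge0// exprn_ege1// ltW.
rewrite rnE tauE -expRD ler_expR; lra.
Qed.

Lemma risk_ge_regimes psi s : 0 < s -> 1 - s / 2 - 3 * (2 * y) / (2 * s) <= risk p rho r psi.
Proof.
move=> s0; have [f fP] := choice (fun CD : {set 'I_n} * {set 'I_n} => data_exists CD.1 CD.2).
pose z C D := (f (C, D)).1.1; pose th C D := (f (C, D)).1.2; pose w C D := (f (C, D)).2.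
have fE C D : data C D (z C D, th C D, w C D).
  by have := fP (C, D); rewrite /z /th /w; case: (f (C, D)) => -[].
apply: (@risk_ge _ _ _ _ _ p01 (ltnW rn) _ z th w tau) => //.
- move=> C Cr; have [r1 H] := plantedC Cr; split=> // e /H[? ? _].
  by split.
- exact: leq_ltn_trans rn.
- by move=> C D Cr DC; have [] := fE C D.
- by move=> C; have [_ ->] := fE C finset.set0.
- by move=> C D Cr DC D0; have [_ _ /(_ Cr DC D0)[]] := fE C D.
- by move=> C D Cr DC D0; have [_ _ /(_ Cr DC D0)[]] := fE C D.
- by move=> C Cr; rewrite /tau -Cr; apply: sum_subsets_le => //; exact: ltW.
Qed.

End Regimes.

(** * Verifying the regimes for a fixed [n] *)

Section DeterministicRegimes.
#[local] Set Implicit Arguments.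
#[local] Unset Strict Implicit.
#[local] Unset Printing Implicit Defensive.
Variables (R : realType) (n r : nat) (p : 'I_n -> 'I_n -> R).
Implicit Types (C D : {set 'I_n}).

Lemma mean_edges_pbar D : mean_edges p D = pbar p D * (#|D|%:R * (#|D|%:R - 1) / 2).
Proof.
have binE (k : nat) : 'C(k, 2)%:R = k%:R * (k%:R - 1) / 2 :> R.
  elim: k => [|k IH]; first by rewrite bin0n !mul0r.
  by rewrite binS bin1 natrD IH -[k.+1]addn1 natrD; lra.
(* For [#|D| < 2] the quotient [pbar] divides by zero, but then [D] contains no edge. *)
rewrite -binE /pbar; have [D0|D0] := eqVneq 'C(#|D|, 2) 0%N; last first.
  by rewrite divfK// pnatr_eq0.
rewrite D0 mulr0 mean_edgesE big1// => e eD; exfalso; move/eqP: D0.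
rewrite -leqn0 leqNgt bin_gt0 => /negP; apply.
move: eD; rewrite inE => /andP[e1 e2].
rewrite ltnNge; apply/negP => /card_le1_eqP/(_ _ _ e1 e2)/eqP.
by rewrite eq_sym; apply: (negP (vpair_neq e)).
Qed.

Variables (C : {set 'I_n}) (rh eps : R).
Hypotheses (Cr : #|C| = r) (rn : (r < n)%N) (rh1 : 1 < rh).
Hypotheses (EC0 : 0 < mean_edges p C) (eps0 : 0 < eps) (eps12 : eps <= 1/2).
Hypothesis budget : mean_edges p C * hfun (rh - 1) <= (1 - eps) * (r%:R * ln (n%:R / r%:R)).

Lemma community_size_ge2 : 2 <= r%:R :> R.
Proof.
rewrite ler_nat ltnNge; apply/negP => r1; move: EC0; rewrite mean_edgesE big1 ?ltxx// => e.
rewrite inE => /andP[e1 e2]; exfalso; have := vpair_neq e.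
by rewrite ((@card_le1_eqP _ (mem C) _) _ _ e1 e2) ?eqxx// Cr.
Qed.

Lemma pbar_gt0 : 0 < pbar p C.
Proof.
have r2 := community_size_ge2; move: EC0; rewrite mean_edges_pbar Cr.
by rewrite pmulr_lgt0// divr_gt0// mulr_gt0; lra.
Qed.

(** The budget at [D = C], with [r <= 2 * (r - 1)]. *)
Lemma hfun_le_pbar : r%:R * pbar p C * hfun (rh - 1) <= 4 * ln (n%:R / r%:R).
Proof.
have [[eps_gt0 eps_le] rh_gt1] := (eps0, eps12, rh1).
have r2 := community_size_ge2; have P0 := pbar_gt0.
have h0 := hfun_ge0 (ltW rh1).
have l0 : 0 <= ln (n%:R / r%:R :> R).
  by rewrite ln_ge0// ler_pdivlMr ?mul1r ?ler_nat 1?ltnW//; lra.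
move: budget; rewrite mean_edges_pbar Cr => bud.
have Ph : 0 <= pbar p C * hfun (rh - 1) by rewrite mulr_ge0// ltW.
have : r%:R * (pbar p C * hfun (rh - 1) * (r%:R - 1)) <= r%:R * (2 * ln (n%:R / r%:R)).
  have : 0 <= eps * (r%:R * ln (n%:R / r%:R)).
    by apply: mulr_ge0; [exact: ltW|apply: mulr_ge0].
  by lra.
rewrite ler_pM2l; last by lra.
move=> h1; have : pbar p C * hfun (rh - 1) * r%:R <= pbar p C * hfun (rh - 1) * (2 * (r%:R - 1)).
  by apply: ler_wpM2l => //; lra.
by lra.
Qed.

(** If [rh > 1 + b], then [hfun_sqr_le] makes [hfun (rh - 1)] exceed [b ^+ 2 / (2 * (1 + b))],
    whereas [hfun_le_pbar] allows only half of that. *)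
Lemma rho_near1 b : 0 < b ->
  (pbar p C)^-1 <= b ^+ 2 / (16 * (1 + b)) * (r%:R / ln (n%:R / r%:R)) -> rh <= 1 + b.
Proof.
have rh_gt1 := rh1; move=> b0 hP; rewrite leNgt; apply/negP => brh.
have r2 := community_size_ge2; have P0 := pbar_gt0; have hh := hfun_le_pbar.
have l0 : 0 < ln (n%:R / r%:R :> R).
  by rewrite ln_gt0// ltr_pdivlMr ?mul1r ?ltr_nat//; lra.
have b16 : 0 < 16 * (1 + b) by lra.
have hl : (16 * (1 + b)) * ln (n%:R / r%:R) <= b ^+ 2 * (r%:R * pbar p C).
  have h1 : 1 <= b ^+ 2 / (16 * (1 + b)) * (r%:R / ln (n%:R / r%:R)) * pbar p C.
    by rewrite -ler_pdivrMr// div1r.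
  have q0 : 0 <= 16 * (1 + b) * ln (n%:R / r%:R) by rewrite mulr_ge0// ltW.
  have := ler_wpM2l q0 h1; rewrite mulr1 => /le_trans; apply.
  by rewrite le_eqVlt; apply/orP; left; apply/eqP; field; rewrite !gt_eqF//; lra.
have rP0 : 0 < r%:R * pbar p C by rewrite mulr_gt0//; lra.
have h4 : 4 * (1 + b) * hfun (rh - 1) <= b ^+ 2.
  rewrite -(ler_pM2l rP0).
  have b1 : 0 <= 1 + b by lra.
  by have := ler_wpM2l b1 hh; lra.
have hs := hfun_sqr_le (ltW rh1).
have rh0 : 0 <= rh by lra.
have h5 := ler_wpM2l rh0 h4.
have b2 : 0 <= 2 * (1 + b) by lra.
have h6 := ler_wpM2l b2 hs.
have h7 : 2 * (1 + b) * (rh - 1) ^+ 2 <= rh * b ^+ 2 by lra.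
have h8 : b ^+ 2 < (rh - 1) ^+ 2 by rewrite ltr_pXn2r ?nnegrE//; lra.
have h9 : 0 <= (rh - 1) * b ^+ 2 by rewrite mulr_ge0 ?sqr_ge0//; lra.
have h11 := sqr_ge0 b.
have h10 : (rh - 1) * b ^+ 2 <= (rh - 1) * (b * (rh - 1)).
  by apply: ler_wpM2l; [lra|rewrite expr2 ler_wpM2l; lra].
by lra.
Qed.

(** For small [D], the [delta] bound transfers the budget of [C] to [D], and [rh] near [1] makes
    [(rh - 1) ^+ 2] about [2 * hfun (rh - 1)]; the cost, about [2 * delta * ln (n / r)] per vertex,
    fits below [ln (n / r ^ 2)]. For larger [D], [ln (r / #|D|)] is at most [gamma * ln (n / r)], so
    truncation works. *)
Lemma regime_dense (delta gamma lnK M : R) D : D \subset C -> D != finset.set0 ->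
  0 < delta -> delta < 1/2 -> 0 <= M ->
  (pbar p C)^-1 <= (eps / 8) ^+ 2 / (16 * (1 + eps / 8)) * (r%:R / ln (n%:R / r%:R)) ->
  (#|D|%:R < r%:R / ((n%:R / r%:R) `^ gamma) ->
   (#|D|%:R * pbar p D) / (#|C|%:R * pbar p C) <= delta) ->
  gamma <= eps ^+ 2 / 8 / 8 -> 4 * M <= eps ^+ 2 / 8 * ln (n%:R / r%:R) ->
  ln r%:R <= lnK + (1/2 - delta) * ln n%:R ->
  2 * lnK + M <= delta * eps * ln n%:R ->
  2 * ln (r%:R / #|D|%:R) + M <=
    eps ^+ 2 / 8 / (1 + ln rh) * ln (n%:R / #|D|%:R) \/
  mean_edges p D * ((rh - 1) ^+ 2 * (1 + eps ^+ 2 / 16)) <=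
    #|D|%:R * (ln (n%:R / r%:R) + ln (#|D|%:R / r%:R) - M).
Proof.
have [[eps_gt0 eps_le] rh_gt1] := (eps0, eps12, rh1).
move=> DC D0 d0 d12 M0 hP hD hg hM hr hn.
have rhb : rh <= 1 + eps / 8 by apply: rho_near1 => //; rewrite divr_gt0.
have r2 := community_size_ge2; have P0 := pbar_gt0.
have k1 : 1 <= #|D|%:R :> R by rewrite ler1n card_gt0.
have kr : #|D|%:R <= r%:R :> R by rewrite ler_nat -Cr subset_leq_card.
have rn' : r%:R < n%:R :> R by rewrite ltr_nat.
have [n0 r0 k0] : [/\ 0 < n%:R :> R, 0 < r%:R :> R & 0 < #|D|%:R :> R] by split; lra.
have lk0 : 0 <= ln #|D|%:R :> R by rewrite ln_ge0.
have lkr : ln #|D|%:R <= ln r%:R :> R by rewrite ler_ln ?posrE.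
have lrn : ln r%:R < ln n%:R :> R by rewrite ltr_ln ?posrE.
have nr0 : 0 < n%:R / r%:R :> R by rewrite divr_gt0.
have [hk|hk] := ltP (#|D|%:R : R) (r%:R / ((n%:R / r%:R) `^ gamma)).
  have rP0 : 0 < r%:R * pbar p C by exact: mulr_gt0.
  right; have {hD} := hD hk; rewrite Cr ler_pdivrMr// => hD.
  have ED : r%:R * mean_edges p D <= delta * #|D|%:R * mean_edges p C.
    rewrite !mean_edges_pbar Cr.
    have h1 : 0 <= r%:R * (#|D|%:R - 1) / 2 :> R by rewrite !mulr_ge0//; lra.
    have := ler_wpM2l h1 hD.
    have h2 : 0 <= delta * (r%:R * pbar p C) / 2 by rewrite !mulr_ge0// ltW.
    have h3 : r%:R * (#|D|%:R - 1) <= #|D|%:R * (r%:R - 1) :> R by lra.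
    by have := ler_wpM2l h2 h3; lra.
  have rhC : (rh - 1) ^+ 2 * mean_edges p C <=
      2 * (1 + eps / 8) * ((1 - eps) * (r%:R * ln (n%:R / r%:R))).
    have := ler_wpM2r (ltW EC0) (hfun_sqr_le (ltW rh1)).
    have Eh0 : 0 <= mean_edges p C * hfun (rh - 1).
      by rewrite mulr_ge0 ?hfun_ge0// ltW.
    have := ler_wpM2r Eh0 rhb.
    have b1 : 0 <= 1 + eps / 8 by lra.
    by have := ler_wpM2l b1 budget; lra.
  set l := ln (n%:R / r%:R) in hM rhC *.
  have lE : l = ln n%:R - ln r%:R by rewrite /l ln_div ?posrE.
  have l0 : 0 <= l by lra.
  have key : mean_edges p D * ((rh - 1) ^+ 2 * (1 + eps ^+ 2 / 16)) <=
      #|D|%:R * (2 * delta * (1 - eps / 2) * l).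
    rewrite -(ler_pM2l r0).
    have q0 : 0 <= (rh - 1) ^+ 2 * (1 + eps ^+ 2 / 16).
      by rewrite mulr_ge0 ?sqr_ge0// addr_ge0// mulr_ge0 ?sqr_ge0.
    have := ler_wpM2r q0 ED.
    have q1 : 0 <= delta * #|D|%:R * (1 + eps ^+ 2 / 16).
      rewrite mulr_ge0 ?mulr_ge0//; [exact: ltW|].
      by rewrite addr_ge0// mulr_ge0 ?sqr_ge0.
    have := ler_wpM2l q1 rhC.
    have q2 : 0 <= 2 * delta * #|D|%:R * (r%:R * l).
      by rewrite !mulr_ge0// ltW.
    (* Half of the slack [eps] survives all the error factors. *)
    have q3 : (1 + eps ^+ 2 / 16) * (1 + eps / 8) * (1 - eps) <= 1 - eps / 2.
      by nra.
    by have := ler_wpM2l q2 q3; lra.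
  apply: (le_trans key); apply: ler_wpM2l; first exact: ltW.
  rewrite ln_div ?posrE//.
  have d1 : 0 <= 2 * delta * (1 - eps / 2) by rewrite !mulr_ge0//; lra.
  have ln0 : l <= ln n%:R by lra.
  by have := ler_wpM2l d1 ln0; lra.
left; have hlk : ln (r%:R / #|D|%:R) <= gamma * ln (n%:R / r%:R) :> R.
  have : ln (r%:R / (n%:R / r%:R) `^ gamma) <= ln #|D|%:R :> R.
    by rewrite ler_ln ?posrE// divr_gt0// powR_gt0.
  by rewrite ln_div ?posrE ?powR_gt0// ln_powR (ln_div (x := r%:R)) ?posrE//; lra.
have ln_rh : 1 + ln rh <= 2 by have := ln_le_subr1 (lt_trans ltr01 rh_gt1); lra.
have ln_rh0 : 0 <= ln rh by rewrite ln_ge0// ltW.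
have lnk : ln (n%:R / r%:R) <= ln (n%:R / #|D|%:R) :> R.
  by rewrite !ln_div ?posrE//; lra.
have l0 : 0 <= ln (n%:R / r%:R) :> R by rewrite ln_div ?posrE//; lra.
rewrite mulrAC ler_pdivlMr; last by lra.
have e0 := sqr_ge0 eps.
apply: (@le_trans _ _ (eps ^+ 2 / 8 * ln (n%:R / r%:R))); last first.
  by apply: ler_wpM2l => //; rewrite mulr_ge0.
have gl := ler_wpM2r l0 hg.
have h1 : 2 * ln (r%:R / #|D|%:R) + M <= eps ^+ 2 / 8 * ln (n%:R / r%:R) / 2 by lra.
have h2 : 0 <= 1 + ln rh by lra.
apply: (le_trans (ler_wpM2r h2 h1)).
have h3 : 0 <= eps ^+ 2 / 8 * ln (n%:R / r%:R) / 2.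
  by rewrite divr_ge0// mulr_ge0// divr_ge0.
by have := ler_wpM2l h3 ln_rh; lra.
Qed.

(** It suffices that [ln r * (1 + ln rh)] be a small multiple of [ln (n / r)]. For [rh > 4],
    [hfun_le_pbar] bounds [ln rh] by [15 + ln (ln (n / r)) - ln r + ln (1 / pbar)]; after
    multiplication by [ln r], the negative square absorbs the double logarithm. *)
Lemma regime_sparse (M s : R) D : D \subset C -> D != finset.set0 -> 0 <= M ->
  s = eps ^+ 2 / 8 / (18 * (2 + 2 * M)) ->
  ln r%:R <= s * ln (n%:R / r%:R) ->
  ln (ln (n%:R / r%:R)) ^+ 2 <= s * ln (n%:R / r%:R) ->
  ln ((pbar p C)^-1) <= s * (ln (n%:R / r%:R) / ln r%:R) ->
  2 * ln (r%:R / #|D|%:R) + M <=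
    eps ^+ 2 / 8 / (1 + ln rh) * ln (n%:R / #|D|%:R).
Proof.
have [[eps_gt0 eps_le] rh_gt1] := (eps0, eps12, rh1).
move=> DC D0 M0 sE ha hl hP.
have r2 := community_size_ge2; have P0 := pbar_gt0; have hh := hfun_le_pbar.
have k1 : 1 <= #|D|%:R :> R by rewrite ler1n card_gt0.
have kr : #|D|%:R <= r%:R :> R by rewrite ler_nat -Cr subset_leq_card.
have rn' : r%:R < n%:R :> R by rewrite ltr_nat.
have [n0 r0 k0] : [/\ 0 < n%:R :> R, 0 < r%:R :> R & 0 < #|D|%:R :> R] by split; lra.
have lk0 : 0 <= ln #|D|%:R :> R by rewrite ln_ge0.
have lkr : ln #|D|%:R <= ln r%:R :> R by rewrite ler_ln ?posrE.
have lrn : ln r%:R < ln n%:R :> R by rewrite ltr_ln ?posrE.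
have a12 : 1/2 <= ln r%:R :> R.
  have h : 1 - r%:R^-1 <= ln r%:R :> R.
    have rV0 : 0 < r%:R^-1 :> R by rewrite invr_gt0.
    by have := ln_le_subr1 rV0; rewrite lnV ?posrE//; lra.
  have : r%:R^-1 <= 2^-1 :> R by rewrite lef_pV2 ?posrE.
  by lra.
have lE : ln (n%:R / r%:R) = ln n%:R - ln r%:R :> R by rewrite ln_div ?posrE.
have lD : ln (n%:R / #|D|%:R) = ln n%:R - ln #|D|%:R :> R by rewrite ln_div ?posrE.
set l := ln (n%:R / r%:R) in hh ha hl hP lE *; set a := ln r%:R in ha hP lE a12 lkr lrn *.
have l0 : 0 < l by lra.
have hPa : a * ln ((pbar p C)^-1) <= s * l.
  have a0 : 0 < a by lra.
  by rewrite mulrC -ler_pdivlMr// -mulrA.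
have ln_rh0 : 0 <= ln rh by rewrite ln_ge0// ltW.
have key : a * (1 + ln rh) <= 18 * s * l.
  have sl : 0 <= s * l by lra.
  have [rh4|rh4] := leP rh 4.
    have h3 : ln rh <= 3 by have := ln_le_subr1 (lt_trans ltr01 rh_gt1); lra.
    have a0 : 0 <= a by lra.
    by have := ler_wpM2l a0 h3; lra.
  have rhl : rh <= 16 * l * (r%:R^-1 * (pbar p C)^-1).
    have rP0 : 0 < r%:R * pbar p C by rewrite mulr_gt0.
    rewrite -invfM ler_pdivlMr// mulrC.
    have h4 : rh <= 4 * hfun (rh - 1).
      have := hfun_sqr_le (ltW rh1).
      have rh0 : 0 < rh by lra.
      move=> h; rewrite -(ler_pM2l rh0); nra.
    by have := ler_wpM2l (ltW rP0) h4; lra.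
  have rV0 : 0 < r%:R^-1 :> R by rewrite invr_gt0.
  have PV0 : 0 < (pbar p C)^-1 by rewrite invr_gt0.
  have rP0 : 0 < r%:R^-1 * (pbar p C)^-1 by exact: mulr_gt0.
  have l160 : 0 < 16 * l by lra.
  have : ln rh <= ln (16 * l * (r%:R^-1 * (pbar p C)^-1)).
    by rewrite ler_ln ?posrE//; [lra|exact: mulr_gt0].
  rewrite (lnM (x := 16 * l)) ?posrE// (lnM (x := 16)) ?posrE//.
  rewrite (lnM (x := r%:R^-1)) ?posrE//.
  rewrite (lnV (x := r%:R)) ?posrE// -/a.
  have l16 : ln 16 <= 15 :> R.
    have h16 : 0 < 16 :> R by lra.
    by have := ln_le_subr1 h16; lra.
  move=> lrh; have a0 : 0 <= a by lra.
  (* This gives [a * ln l - a ^+ 2 <= ln l ^+ 2 / 4], which is at most [s * l / 4]. *)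
  have := sqr_ge0 (2 * a - ln l).
  have lrh' : ln rh <= 15 + ln l + (- a + ln (pbar p C)^-1) by lra.
  by have := ler_wpM2l a0 lrh'; lra.
rewrite mulrAC ler_pdivlMr; last by lra.
have lnk : l <= ln (n%:R / #|D|%:R) by rewrite lD; lra.
have e0 := sqr_ge0 eps.
apply: (@le_trans _ _ (eps ^+ 2 / 8 * l)); last first.
  by apply: ler_wpM2l => //; rewrite mulr_ge0.
rewrite ln_div ?posrE// -/a.
(* Since [a >= 1/2], the constant [M] is at most [2 * M * a]. *)
apply: (@le_trans _ _ ((2 + 2 * M) * a * (1 + ln rh))).
  apply: ler_wpM2r; first by lra.
  by have := ler_wpM2l M0 a12; lra.
have M2 : 0 <= 2 + 2 * M by lra.
have := ler_wpM2l M2 key; rewrite mulrA => /le_trans; apply.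
by rewrite sE le_eqVlt; apply/orP; left; apply/eqP; field; lra.
Qed.

End DeterministicRegimes.

(** * Either assumption yields the regimes for all large [n] *)

Section EventualRegimes.
Variables (R : realType) (p : forall n, 'I_n -> 'I_n -> R) (r : nat -> nat).
#[local] Set Implicit Arguments.
#[local] Unset Strict Implicit.
#[local] Unset Printing Implicit Defensive.
Variables (eps M : R).
Hypotheses (eps0 : 0 < eps) (eps12 : eps <= 1/2) (M0 : 0 <= M).

Lemma near_le_ln (B : R) : \forall n \near \oo, B <= ln n%:R.
Proof.
exists (Num.bound (expR B)) => // n /= Bn.
rewrite -ler_expR lnK.
  apply: le_trans (ltW (archi_boundP (expR_ge0 B))) _.
  by rewrite ler_nat.
rewrite posrE ltr0n; apply: leq_trans Bn.
by rewrite -(ltr_nat R) (le_lt_trans (expR_ge0 B))// archi_boundP ?expR_ge0.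
Qed.

(** With [t] the fourth root of [x], [ln x = 4 * ln t <= 4 * t], so the square is at most [16] times
    the square root of [x]. *)
Lemma ln_sqr_le_linear (s x : R) : 0 < s -> 1 <= x -> (16 / s) ^+ 2 <= x ->
  ln x ^+ 2 <= s * x.
Proof.
move=> s0 x1 sx; have x0 : 0 < x by lra.
pose t := Num.sqrt (Num.sqrt x).
have t0 : 0 < t by rewrite !sqrtr_gt0.
have xt : x = (t ^+ 2) ^+ 2 by rewrite !sqr_sqrtr ?sqrtr_ge0 ?ltW.
have st : 16 / s <= t ^+ 2.
  have q : 0 <= 16 / s by rewrite divr_ge0 ?ltW.
  by move: sx; rewrite xt ler_pXn2r// nnegrE ?q// ?sqr_ge0.
have lx : ln x <= 4 * t.
  rewrite xt -exprM (_ : (2 * 2)%N = 4)// lnXn// -(mulr_natl (ln t)) ler_pM2l//.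
  exact/ltW/ln_sublinear.
have : ln x ^+ 2 <= (4 * t) ^+ 2.
  by rewrite ler_pXn2r// nnegrE ?ln_ge0// mulr_ge0// ltW.
move/le_trans; apply.
have := ler_wpM2r (sqr_ge0 t) st.
move/(ler_wpM2l (ltW s0)); rewrite xt.
have -> : s * (16 / s * t ^+ 2) = (4 * t) ^+ 2 by field; rewrite gt_eqF.
by rewrite [(t ^+ 2) ^+ 2]expr2.
Qed.

(** [rh] stands for [rho n C], about which only the budget at [D = C] and [1 < rh] are retained. *)
Definition regimes n := (r n < n)%N /\ forall (C : {set 'I_n}) (rh : R),
  #|C| = r n -> 0 < mean_edges (p n) C -> 1 < rh ->
  mean_edges (p n) C * hfun (rh - 1) <= (1 - eps) * ((r n)%:R * ln (n%:R / (r n)%:R)) ->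
  forall D : {set 'I_n}, D \subset C -> D != finset.set0 ->
  2 * ln ((r n)%:R / #|D|%:R) + M <=
    eps ^+ 2 / 8 / (1 + ln rh) * ln (n%:R / #|D|%:R) \/
  mean_edges (p n) D * ((rh - 1) ^+ 2 * (1 + eps ^+ 2 / 16)) <=
    #|D|%:R * (ln (n%:R / (r n)%:R) + ln (#|D|%:R / (r n)%:R) - M).

Lemma ltn_of_ln n k : (0 < n)%N -> (ln k%:R < ln n%:R :> R) -> (k < n)%N.
Proof.
move=> n0 h; have [->//|k0] := posnP k.
by rewrite -(ltr_nat R) -ltr_ln ?posrE ?ltr0n.
Qed.

Lemma gt0_of_ln_gt0 n : 0 < ln n%:R :> R -> (0 < n)%N.
Proof. by case: n => //; rewrite ln0// ltxx. Qed.

Lemma regimes_assumption11 : Assumption11 p r -> \forall n \near \oo, regimes n.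
Proof.
case=> delta [d0 [d12 [[K hK] [[gamma [_ [gamma0 hD]]] hP]]]].
pose lnK := ln (Num.max K 1); pose c := eps ^+ 2 / 8.
have lnK0 : 0 <= lnK by rewrite ln_ge0// le_max lexx orbT.
have c0 : 0 < c by rewrite divr_gt0// exprn_gt0.
have b0 : 0 < (eps / 8) ^+ 2 / (16 * (1 + eps / 8)).
  have e8 : 0 < eps / 8 by rewrite divr_gt0.
  by rewrite divr_gt0 ?exprn_gt0// mulr_gt0// addr_gt0.
have c8 : 0 < c / 8 by rewrite divr_gt0.
have de0 : 0 < delta * eps by rewrite mulr_gt0.
(* The first summand meets the last numeric condition of [regime_dense]; the others give [r n < n]
   and [ln (n / r n) >= 4 * M / c], because [ln (r n) <= lnK + ln n / 2]. *)
pose B := (2 * lnK + M) / (delta * eps) + (2 * lnK + 8 * M / c + 1).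
have B1 : 0 <= (2 * lnK + M) / (delta * eps).
  by apply: divr_ge0; [rewrite addr_ge0// mulr_ge0|exact: ltW].
have B2 : 0 <= 8 * M / c by apply: divr_ge0; [rewrite mulr_ge0|exact: ltW].
have gammac : \forall n \near \oo, `|gamma n| < c / 8 by exact: cvgr0_norm_lt.
have hP' := hP _ b0; have hB := near_le_ln B.
near=> n.
have LB : B <= ln n%:R by near: n.
have L1 : 1 <= ln n%:R :> R by apply: le_trans LB; rewrite /B; lra.
have n0 : (0 < n)%N by apply: gt0_of_ln_gt0; lra.
have n0' : 0 < n%:R :> R by rewrite ltr0n.
have rK : (r n)%:R <= K * (n%:R `^ (1 / 2 - delta)) by near: n.
have gn : `|gamma n| < c / 8 by near: n.
have hDn : forall C D : {set 'I_n}, #|C| = r n -> D \subset C ->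
        (#|D|%:R : R) < (r n)%:R / (((n%:R : R) / (r n)%:R) `^ gamma n) ->
        (#|D|%:R * pbar (p n) D) / (#|C|%:R * pbar (p n) C) <= delta by near: n.
have hPn : `|Defs.maxC (r n) (fun C => (pbar (p n) C)^-1)| <=
  (eps / 8) ^+ 2 / (16 * (1 + eps / 8)) * `|(r n)%:R / ln (n%:R / (r n)%:R)| by near: n.
have lr : ln (r n)%:R <= lnK + (1 / 2 - delta) * ln n%:R.
  have [->|r0] := posnP (r n).
    by rewrite ln0// addr_ge0// mulr_ge0//; lra.
  have r0' : 0 < (r n)%:R :> R by rewrite ltr0n.
  have pw0 : 0 < n%:R `^ (1 / 2 - delta) by rewrite powR_gt0.
  have K1 : 0 < Num.max K 1 by rewrite lt_max ltr01 orbT.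
  rewrite -ln_powR -lnM ?posrE// ler_ln ?posrE// ?mulr_gt0//.
  by apply: (le_trans rK); rewrite ler_wpM2r ?(ltW pw0)// le_max lexx.
have dL : 0 <= delta * ln n%:R by rewrite mulr_ge0; lra.
have rn : (r n < n)%N by apply: ltn_of_ln => //; move: LB; rewrite /B; lra.
split=> // C rh Cr EC0 rh1 bud D DC D0.
have r0 : (0 < r n)%N by rewrite -(ltr_nat R); have := community_size_ge2 Cr EC0; lra.
have r0' : 0 < (r n)%:R :> R by rewrite ltr0n.
have lE : ln (n%:R / (r n)%:R) = ln n%:R - ln (r n)%:R :> R by rewrite ln_div ?posrE.
apply: (regime_dense Cr rn rh1 EC0 eps0 eps12 bud DC D0 d0 d12 M0 _ _ _ _ lr).
- apply: (le_trans (le_maxC (fun C => (pbar (p n) C)^-1) Cr)).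
  apply: (le_trans (ler_norm _)); apply: (le_trans hPn).
  rewrite ger0_norm// divr_ge0// lE; move: LB; rewrite /B; lra.
- exact: hDn.
- exact: le_trans (ler_norm _) (ltW gn).
- rewrite lE -/c.
  have : c * (4 * M / c) <= c * (ln n%:R - ln (r n)%:R).
    by apply: ler_wpM2l; [exact: ltW|move: LB; rewrite /B; lra].
  by rewrite [X in X <= _]mulrCA mulfV ?gt_eqF// mulr1.
- have : (2 * lnK + M) / (delta * eps) <= ln n%:R by move: LB; rewrite /B; lra.
  by rewrite ler_pdivrMr// [X in _ <= X]mulrC.
Unshelve. all: by end_near. Qed.

Lemma regimes_assumption12 : Assumption12 p r -> \forall n \near \oo, regimes n.
Proof.
case=> -[f [f0 hf]] hP.
pose s := eps ^+ 2 / 8 / (18 * (2 + 2 * M)).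
have M2 : 1 <= 18 * (2 + 2 * M) by have := M0; lra.
have e20 : 0 < eps ^+ 2 / 8 by rewrite divr_gt0// exprn_gt0.
have s0 : 0 < s by rewrite divr_gt0//; lra.
have s1 : s <= 1.
  rewrite ler_pdivrMr ?mul1r; last by lra.
  have : eps ^+ 2 <= 1 by rewrite exprn_ile1 ?(ltW eps0)//; have := eps12; lra.
  by lra.
(* An exponent [f n <= s / (1 + s)] amounts to [ln (r n) <= s * ln (n / r n)]. *)
have t0 : 0 < s / (1 + s) by rewrite divr_gt0//; lra.
have fs : \forall n \near \oo, `|f n| < s / (1 + s) by exact: cvgr0_norm_lt.
(* As [s <= 1], [ln (n / r n)] is at least half of [ln n]; this accounts for the factor [2]. *)
pose B := 2 * (1 + (16 / s) ^+ 2).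
have hP' := hP _ s0; have hB := near_le_ln B.
near=> n.
have LB : B <= ln n%:R by near: n.
have s16 := sqr_ge0 (16 / s).
have L1 : 1 <= ln n%:R :> R by apply: le_trans LB; rewrite /B; lra.
have n0 : (0 < n)%N by apply: gt0_of_ln_gt0; lra.
have n0' : 0 < n%:R :> R by rewrite ltr0n.
have rE : (r n)%:R = n%:R `^ f n by near: n.
have fn : `|f n| < s / (1 + s) by near: n.
have hPn : `|Defs.maxC (r n) (fun C => ln ((pbar (p n) C)^-1))| <=
  s * `|ln (n%:R / (r n)%:R) / ln (r n)%:R| by near: n.
have r0' : 0 < (r n)%:R :> R by rewrite rE powR_gt0.
have lE : ln (n%:R / (r n)%:R) = ln n%:R - ln (r n)%:R :> R by rewrite ln_div ?posrE.
have lrs : ln (r n)%:R * (1 + s) <= s * ln n%:R.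
  have : f n <= s / (1 + s) by exact: le_trans (ler_norm _) (ltW fn).
  rewrite ler_pdivlMr; last by lra.
  move=> h; have L0 : 0 <= ln n%:R :> R by lra.
  by have := ler_wpM2r L0 h; rewrite {1}rE ln_powR; lra.
have lr : ln (r n)%:R <= s * ln (n%:R / (r n)%:R) by rewrite lE; lra.
have lr0 : 0 <= ln (r n)%:R :> R.
  by rewrite ln_ge0// ler1n -(ltr_nat R).
have l2 : 1 + (16 / s) ^+ 2 <= ln (n%:R / (r n)%:R).
  have sl : s * ln (n%:R / (r n)%:R) <= ln (n%:R / (r n)%:R).
    rewrite ler_piMl// leNgt; apply/negP => neg.
    have := ler_wnM2r (ltW neg) (ltW s0); rewrite mul0r; lra.
  by move: LB; rewrite /B; lra.
have rn : (r n < n)%N by apply: ltn_of_ln => //; lra.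
split=> // C rh Cr EC0 rh1 bud D DC D0; left.
apply: (regime_sparse Cr rn rh1 EC0 eps0 eps12 bud DC D0 M0 (erefl s) lr).
  by apply: ln_sqr_le_linear => //; lra.
apply: (le_trans (le_maxC (fun C => ln ((pbar (p n) C)^-1)) Cr)).
apply: (le_trans (ler_norm _)); apply: (le_trans hPn).
by rewrite ger0_norm// divr_ge0//; lra.
Unshelve. all: by end_near. Qed.

End EventualRegimes.

(** * Asymptotic powerlessness from the bounds at fixed [n] *)

Theorem theorem1 (R : realType) (eps : R)
  (p : forall n, 'I_n -> 'I_n -> R) (r : nat -> nat)
  (rho : forall n, {set 'I_n} -> R) :
  0 < eps -> eps < 1 ->
  (forall n (i j : 'I_n), p n i j = p n j i) ->
  (forall n (i j : 'I_n), i != j -> 0 <= p n i j <= 1) ->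
  (forall n (C : {set 'I_n}), #|C| = r n ->
     1 < rho n C /\
     forall i j, i \in C -> j \in C -> i != j -> rho n C * p n i j <= 1) ->
  Assumption2 p rho r ->
  (Assumption11 p r \/ Assumption12 p r) ->
  (\forall n \near \oo, forall C : {set 'I_n}, #|C| = r n ->
     forall D : {set 'I_n}, D != finset.set0 -> D \subset C ->
       mean_edges (p n) D * hfun (rho n C - 1)
         / (#|D|%:R * ln ((n%:R : R) / #|D|%:R)) <= 1 - eps) ->
  forall psi : forall n, test n,
  forall eta : R, 0 < eta ->
    \forall n \near \oo, 1 - eta <= risk (p n) (rho n) (r n) (psi n).
Proof.
move=> eps0 _ _ p01 rhoC A2 A1 bud psi eta eta0.
(* [risk_ge_regimes] is used with [s = eta]; the choice [y <= eta ^+ 2 / 6] makes its last error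
   term at most [eta / 2]. *)
pose e := Num.min eps (1/2); pose y := Num.min (1/2) (eta ^+ 2 / 6).
have e0 : 0 < e by rewrite lt_min eps0 divr_gt0.
have e12 : e <= 1/2 by rewrite ge_min lexx orbT.
have ee : e <= eps by rewrite ge_min lexx.
have y0 : 0 < y by rewrite lt_min !divr_gt0// exprn_gt0.
have y12 : y <= 1/2 by rewrite ge_min lexx.
have yeta : 6 * y <= eta ^+ 2.
  have : y <= eta ^+ 2 / 6 by rewrite ge_min lexx orbT.
  by lra.
have M0 : 0 <= 1 - ln y.
  have : ln y <= 0 by apply: ln_le0; lra.
  by lra.
have reg : \forall n \near \oo, regimes p r e (1 - ln y) n.
  case: A1; [exact: regimes_assumption11|exact: regimes_assumption12].
(* The additional half pays for [1 / (1 - pe) <= 2], valid once edge probabilities inside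
   communities are at most [1/2]. *)
have k0 : 0 < e ^+ 2 / 16 / 2 by rewrite !divr_gt0// exprn_gt0.
pose a n := Defs.maxC (r n) (fun C => \big[Num.max/0]_(ij : 'I_n * 'I_n |
  (ij.1 \in C) && (ij.2 \in C) && (ij.1 != ij.2)) (rho n C ^+ 2 * p n ij.1 ij.2)).
have A2n : \forall n \near \oo, `|a n| < e ^+ 2 / 16 / 2.
  by apply: cvgr0_norm_lt k0; exact: A2.
near=> n.
have an : `|a n| < e ^+ 2 / 16 / 2 by near: n.
have [rn regn] : regimes p r e (1 - ln y) n by near: n.
have p01e (ed : vpair n) : 0 <= pe (p n) ed <= 1 by apply: p01; exact: vpair_neq.
(* If [pbar C = 0], the junk values [0^-1 = 0] and [ln 0 = 0] hide [C] from the
   assumptions, but then planting [C] does not change the null law. *)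
have [[C [Cr EC]]|ndeg] := pselect (exists C : {set 'I_n}, #|C| = r n /\ mean_edges (p n) C = 0).
  apply: (@le_trans _ _ 1); first by lra.
  apply: (risk_ge1_of_eq _ Cr) => ed; rewrite /planted.
  case: (boolP ((_ \in _) && _)) => // edC.
  suff : pe (p n) ed = 0 by rewrite /pe => ->; rewrite mulr0.
  move/eqP: EC; rewrite mean_edgesE psumr_eq0; last by move=> i _; case/andP: (p01e i).
  by move/allP/(_ ed); rewrite mem_index_enum inE edC => /(_ isT)/eqP.
have EC0 (C : {set 'I_n}) : #|C| = r n -> 0 < mean_edges (p n) C.
  move=> Cr; rewrite lt_neqAle; apply/andP; split.
    by apply/eqP => EC; apply: ndeg; exists C.
  by rewrite mean_edgesE; apply: sumr_ge0 => ed _; case/andP: (p01e ed).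
have r0 : (0 < r n)%N.
  have [C Cr] : exists C : {set 'I_n}, #|C| = r n.
    have : (0 < #|[set C : {set 'I_n} | #|C| == r n]%SET|)%N.
      by rewrite card_draws card_ord bin_gt0 ltnW.
    by rewrite card_gt0 => /set0Pn[C]; rewrite inE => /eqP; exists C.
  by have := community_size_ge2 Cr (EC0 C Cr); rewrite ler_nat => /ltnW.
have budn : forall C D : {set 'I_n}, #|C| = r n -> D \subset C -> D != finset.set0 ->
    mean_edges (p n) D * hfun (rho n C - 1) <= (1 - e) * (#|D|%:R * ln (n%:R / #|D|%:R)).
  move=> C D Cr DC D0.
  have k1 : (0 < #|D|)%N by rewrite card_gt0.
  have W0 : 0 < #|D|%:R * ln (n%:R / #|D|%:R) :> R.
    rewrite mulr_gt0 ?ltr0n// ln_gt0// ltr_pdivlMr ?ltr0n// mul1r ltr_nat.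
    by apply: leq_ltn_trans rn; rewrite -Cr subset_leq_card.
  rewrite -ler_pdivrMr//; apply: (@le_trans _ _ (1 - eps)); last by lra.
  by move: C Cr D D0 DC {k1 W0}; near: n.
have s : 1 - eta / 2 - 3 * (2 * y) / (2 * eta) <= risk (p n) (rho n) (r n) (psi n).
  apply: (risk_ge_regimes p01e r0 rn e0 e12 y0 y12 _ budn) => //.
    move=> C Cr; have [rh1 rhp] := rhoC n C Cr; split=> // ed edC.
    move: (edC); rewrite inE => /andP[e1 e2].
    have rp : rho n C * pe (p n) ed <= 1 by apply: rhp => //; exact: vpair_neq.
    have r2p : rho n C ^+ 2 * pe (p n) ed <= e ^+ 2 / 16 / 2.
      apply: le_trans (ltW an); apply: le_trans (ler_norm _).
      apply: le_trans (le_maxC _ Cr).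
      apply: (le_bigmax_cond _ (P := fun ij : 'I_n * 'I_n =>
        (ij.1 \in C) && (ij.2 \in C) && (ij.1 != ij.2)) (j := val ed)).
      by rewrite e1 e2 vpair_neq.
    have /andP[pe0 _] := p01e ed.
    have e14 : e ^+ 2 <= 1 by rewrite exprn_ile1 ?(ltW e0)//; lra.
    have p12 : pe (p n) ed <= 1/2.
      have : pe (p n) ed <= rho n C ^+ 2 * pe (p n) ed.
        by rewrite ler_peMl// exprn_ege1// ltW.
      by lra.
    split=> //; first by lra.
    rewrite mulrA ler_pdivrMr; last by lra.
    have q0 : 0 <= 1/2 - pe (p n) ed by lra.
    by have := mulr_ge0 (sqr_ge0 e) q0; lra.
  move=> C D Cr DC D0; have [rh1 _] := rhoC n C Cr.
  apply: (regn C (rho n C) Cr (EC0 C Cr) rh1 _ D DC D0).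
  rewrite -{1}Cr -[in X in _ <= X]Cr; apply: budn => //.
  by rewrite -card_gt0 Cr.
apply: le_trans s.
have : 3 * (2 * y) / (2 * eta) <= eta / 2.
  by rewrite ler_pdivrMr ?mulr_gt0//; lra.
by lra.
Unshelve. all: by end_near. Qed.
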